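(* Let $T,d\in\mathbb{N}$ and let $(\Omega,\mathcal{F},\mathbb{P})$ be a probability space with filtration $\mathcal{F}_0\subset\cdots\subset\mathcal{F}_T=\mathcal{F}$. For $t=0,\dots,T-1$ let $v_t:L^0_t\times L^0_t(\mathbb{R}^d)\to L^0_{t+1}$ satisfy: (v1) $v_t$ is $\mathcal{F}_t$-stable; (v2) $v_t$ is sequentially continuous; (v3) $v_t$ is increasing in the first component; (v4) $v_t(x,\lambda z+(1-\lambda)z')\ge\lambda v_t(x,z)+(1-\lambda)v_t(x,z')$ for all $x\in L^0_t$, $z,z'\in L^0_t(\mathbb{R}^d)$ and $\lambda\in L^0_t$ with $0\le\lambda\le1$; (v5) $\mathbb{P}(v_t(x,z)<x\mid\mathcal{F}_t)>0$ on $\{z\ne0\}$ for all $x\in L^0_t$ and $z\in L^0_t(\mathbb{R}^d)$; (v6) $v_t(x,0)=x$ for all $x\in L^0_t$. Let $u_T:L^0_T\to L^0_T$ be the identity, and for $t=0,\dots,T-1$ let $u_t:L^0_t\times\underline{L}^0_{t+1}\times L^0_t(\mathbb{R}^d)\to\underline{L}^0_t$ satisfy: (u1) $u_t$ is $\mathcal{F}_t$-stable; (u2') $u_t$ is increasing in the first and second component; (u3) $u_t$ is sequentially upper semi-continuous; (u4) $u_t(x,\lambda y+(1-\lambda)y',\lambda z+(1-\lambda)z')\ge\min\{u_t(x,y,z),u_t(x,y',z')\}$ for all $x\in L^0_t$, $y,y'\in\underline{L}^0_{t+1}$, $z,z'\in L^0_t(\mathbb{R}^d)$ and $\lambda\in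 L^0_t$ with $0\le\lambda\le1$; (u5) $u_t(x,y+c,z)=u_t(x,y,z)+c$ for all $x\in L^0_t$, $y\in\underline{L}^0_{t+1}$, $z\in L^0_t(\mathbb{R}^d)$ and $c\in L^0_t$; (u6) $\lim_{m\to\infty}u_t(x,my,mz)=-\infty$ a.s. on $\{\mathbb{P}(y<0\mid\mathcal{F}_t)>0\}$ for every $x\in L^0_t$, $z\in L^0_t(\mathbb{R}^d)$ and $y\in\underline{L}^0_{t+1}$; (u7) $u_t(x,0,0)=0$ for all $x\in L^0_t$. Suppose that there exists a constant $K>0$ such that $$\sup_{z\in L^0_t(\mathbb{R}^d)}u_t(x,v_t(x,z),z)-x\le K\quad\text{for all }t=0,\dots,T-1\text{ and }x\in L^0_t.$$ For $t=0,\dots,T-1$ and $x_t\in L^0_t$ put $$C_t(x_t):=\Big\{\big((x_s)_{s=t+1}^T,(z_s)_{s=t}^{T-1}\big):x_{s+1}=v_s(x_s,z_s),\ z_s\in L^0_s(\mathbb{R}^d)\text{ for all }s=t,\dots,T-1\Big\},$$ $$y_t(x_t):=\sup_{((x_s)_{s=t+1}^T,(z_s)_{s=t}^{T-1})\in C_t(x_t)}u_t(x_t,\cdot,z_t)\circ\cdots\circ u_{T-1}(x_{T-1},\cdot,z_{T-1})\circ u_T(x_T),$$ and $y_T:=u_T$. Then for all $t=0,\dots,T$ the function $y_t$ maps $L^0_t$ into $\underline{L}^0_t$, is $\mathcal{F}_t$-stable, increasing and sequentially upper semi-continuous, and these functions can be computed by the backward recursion $$y_T(x_T)=u_T(x_T)=x_T,\qquad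 y_t(x_t)=\max_{z_t\in L^0_t(\mathbb{R}^d)}u_t\big(x_t,y_{t+1}(v_t(x_t,z_t)),z_t\big),\quad t=0,\dots,T-1$$ (in particular, the maxima are attained). Moreover, for every $t\in\{0,\dots,T-1\}$ and $x_t\in L^0_t$, every process $((x_s^* )_{s=t}^T,(z_s^* )_{s=t}^{T-1})$ given by $x_t^*=x_t$ and the forward recursion $$x^*_{s+1}=v_s(x^*_s,z^*_s),\quad\text{where }z^*_s\in\mathop{\rm argmax}_{z_s\in L^0_s(\mathbb{R}^d)}u_s\big(x^*_s,y_{s+1}(v_s(x^*_s,z_s)),z_s\big),\qquad s=t,\dots,T-1,$$ satisfies $((x^*_s)_{s=t+1}^T,(z^*_s)_{s=t}^{T-1})\in C_t(x_t)$ and $$y_t(x_t)=u_t(x_t,\cdot,z^*_t)\circ\cdots\circ u_{T-1}(x^*_{T-1},\cdot,z^*_{T-1})\circ u_T(x^*_T).$$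
   Context: Sets in $\mathcal{F}$ are identified if their symmetric difference is null, and functions on $\Omega$ are identified if they coincide a.s.; inequalities between random variables hold a.s. For $t=0,\dots,T$: $L^0_t$, $\underline{L}^0_t$ and $L^0_t(\mathbb{R}^d)$ are the spaces of $\mathcal{F}_t$-measurable random variables with values in $\mathbb{R}$, $\mathbb{R}\cup\{-\infty\}$ and $\mathbb{R}^d$. $\Pi_{\mathcal{F}_t}$ is the set of countable partitions $(A_k)$ of $\Omega$ with all $A_k\in\mathcal{F}_t$. For $(A_k)\in\Pi_{\mathcal{F}_t}$ the concatenation $\sum_k1_{A_k}x_k$ is the random variable equal to $x_k$ on $A_k$ (for tuples, componentwise). A function $f$ is $\mathcal{F}_t$-stable if $f(\sum_k1_{A_k}x_k)=\sum_k1_{A_k}f(x_k)$ for all $(A_k)\in\Pi_{\mathcal{F}_t}$ and all sequences $(x_k)$ in its domain. All convergence of sequences is almost sure pointwise convergence (in $\mathbb{R}$, $\mathbb{R}^d$, respectively $[-\infty,\infty)$; componentwise on products). $f$ is sequentially continuous if $x_k\to x$ a.s. implies $f(x_k)\to f(x)$ a.s., and sequentially upper semi-continuous if $x_k\to x$ a.s. implies $\limsup_kf(x_k)\le f(x)$ a.s. ''Increasing'' means monotone with respect to the a.s. order: $x\le x'$ implies $f(x)\le f(x')$. Suprema are essential suprema; $\max$ means that the supremum is attained, and argmax is the set of points attaining it. The convention $0\cdot(-\infty)=0$ is used. In the compositions, $u_s(x_s,\cdot,z_s)$ is regarded as a map $\underline{L}^0_{s+1}\to\underline{L}^0_s$,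 and $u_T(x_T)=x_T$ is the element to which the composition is applied. *)

(* Defs.v *)
From HB Require Import structures.
From mathcomp Require Import all_boot all_order all_algebra.
From mathcomp Require Import all_classical all_reals all_analysis measurable_realfun.

Set Implicit Arguments.
Unset Strict Implicit.
Unset Printing Implicit Defensive.
Import Order.TTheory GRing.Theory Num.Theory.
Import numFieldNormedType.Exports.
Local Open Scope classical_set_scope.
Local Open Scope ring_scope.

(* Elements of the spaces L^0 are handled through representatives: random
   variables are plain functions on Omega, and every equality, inequality or
   convergence between them is required almost surely only. Maps between these
   spaces are total functions on representatives, constrained on the intended
   domains only. That they do not depend on the representatives follows from
   (semi)continuity, applied to constant sequences that converge a.s. to
   another representative of their value. *)

Section random_variables.
Context {R : realType} {dO : measure_display} {Omega : measurableType dO}.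
Variable P : probability Omega R.
Implicit Types G : set (set Omega).

Definition sub_measurable G d' (S : measurableType d') (f : Omega -> S) : Prop :=
  measurable_fun [set: g_sigma_algebraType G] (f : g_sigma_algebraType G -> S).

Definition L0 G : set (Omega -> R) := [set x : Omega -> R | sub_measurable G x].

Definition L0vec d G : set (Omega -> 'rV[R]_d) :=
  [set z | forall i, sub_measurable G (fun w => z w ord0 i)].

Definition L0low G : set (Omega -> \bar R) :=
  [set y : Omega -> \bar R | sub_measurable G y /\ \forall w \ae P, (y w < +oo)%E].

(* Finite partitions are included, since blocks may be empty. *)
Definition cpartition G (A : nat -> set Omega) : Prop :=
  [/\ forall k, G (A k), trivIset setT A & \bigcup_k A k = setT].

Definition concat V (A : nat -> set Omega) (x_ : nat -> Omega -> V) : Omega -> V :=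
  fun w => x_ (xget 0%N [set k | A k w]) w.

Definition cvg_as (x_ : nat -> Omega -> R) (x : Omega -> R) : Prop :=
  \forall w \ae P, x_ k w @[k --> \oo] --> x w.

Definition cvge_as (y_ : nat -> Omega -> \bar R) (y : Omega -> \bar R) : Prop :=
  \forall w \ae P, y_ k w @[k --> \oo] --> y w.

Definition cvgvec_as d (z_ : nat -> Omega -> 'rV[R]_d) (z : Omega -> 'rV[R]_d) :
    Prop :=
  \forall w \ae P, forall i, z_ k w ord0 i @[k --> \oo] --> z w ord0 i.

Definition is_cond_prob G (E : set Omega) (p : Omega -> R) : Prop :=
  [/\ sub_measurable G p, P.-integrable setT (EFin \o p) &
    forall A, G A -> (\int[P]_(w in A) (p w)%:E = P (E `&` A))%E].

(* S is a G-measurable version of the essential supremum of A. *)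
Definition is_esssup G (A : set (Omega -> \bar R)) (S : Omega -> \bar R) : Prop :=
  [/\ sub_measurable G S,
      forall f, A f -> \forall w \ae P, (f w <= S w)%E &
      forall S', measurable_fun setT S' ->
        (forall f, A f -> \forall w \ae P, (f w <= S' w)%E) ->
        \forall w \ae P, (S w <= S' w)%E].

(* A choice of such a version; it exists by [is_esssup_esssup] below. *)
Definition esssup G (A : set (Omega -> \bar R)) : Omega -> \bar R :=
  xget (cst -oo%E) [set S | is_esssup G A S].

Definition argmax V G (D : set V) (f : V -> Omega -> \bar R) : set V :=
  [set z | D z /\ f z = esssup G (f @` D) %[ae P]].

Definition is_max V G (D : set V) (f : V -> Omega -> \bar R)
    (M : Omega -> \bar R) : Prop :=
  M = esssup G (f @` D) %[ae P] /\ argmax G D f !=set0.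

Definition stable1 G (f : (Omega -> R) -> Omega -> \bar R) : Prop :=
  forall A x_, cpartition G A -> (forall k, L0 G (x_ k)) ->
    f (concat A x_) = concat A (fun k => f (x_ k)) %[ae P].

Definition increasing1 G (f : (Omega -> R) -> Omega -> \bar R) : Prop :=
  forall x x', L0 G x -> L0 G x' -> (\forall w \ae P, x w <= x' w) ->
    \forall w \ae P, (f x w <= f x' w)%E.

Definition seq_usc1 G (f : (Omega -> R) -> Omega -> \bar R) : Prop :=
  forall x_ x, (forall k, L0 G (x_ k)) -> L0 G x -> cvg_as x_ x ->
    \forall w \ae P, (limn_esup (fun k => f (x_ k) w) <= f x w)%E.

Let superlevel (s : nat -> Omega -> \bar R) (q : rat) : set Omega :=
  \bigcup_n [set w | ((ratr q)%:E < s n w)%E].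

Let flatten (I : countType) V (g : I -> nat -> V) (v0 : V) (n : nat) : V :=
  if unpickle n is Some (i, j) then g i j else v0.

Let flattenE (I : countType) V (g : I -> nat -> V) v0 i j :
  flatten g v0 (pickle (i, j)) = g i j.
Proof. by rewrite /flatten pickleK. Qed.

Let flatten_in (I : countType) V (g : I -> nat -> V) v0 (A : set V) :
  A v0 -> (forall i j, A (g i j)) -> forall n, A (flatten g v0 n).
Proof. by move=> A0 Ag n; rewrite /flatten; case: unpickle => [[i j]|]. Qed.

Let rat_between (a b : \bar R) : (a < b)%E ->
  exists q : rat, (a < (ratr q)%:E < b)%E.
Proof.
have H (x y : R) : x < y -> exists q : rat, x < ratr q < y.
  by move=> /rat_in_itvoo[q]; rewrite in_itv/= => ?; exists q.
case: a b => [a| |] [b| |] //=; rewrite ?lte_fin.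
- by move=> /H.
- move=> _; have [|q /andP[aq _]] := H a (a + 1); first by rewrite ltrDl.
  by exists q; rewrite lte_fin aq ltry.
- move=> _; have [|q /andP[_ aq]] := H (b - 1) b; first by rewrite ltrBlDr ltrDl.
  by exists q; rewrite lte_fin aq ltNyr.
- by move=> _; exists 0; rewrite ltry ltNyr.
Qed.

Lemma is_esssup_esssup G (A : set (Omega -> \bar R)) :
  sigma_algebra setT G -> G `<=` measurable ->
  (forall f, A f -> sub_measurable G f) ->
  is_esssup G A (esssup G A).
Proof.
move=> sG GM AG.
suff [S HS] : exists S, is_esssup G A S.
  exact: (@xgetI _ (cst -oo%E) [set S | is_esssup G A S] S).
have [->|/set0P[f0 Af0]] := eqVneq A set0.
  exists (cst -oo%E); split => //; first exact: measurable_cst.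
  by move=> S' _ _; apply: aeW => w; rewrite leNye.
have mA f : A f -> measurable_fun setT f.
  move=> /AG mf _ B mB; have := mf measurableT B mB.
  rewrite setTI /measurable/= sigma_algebra_id// => GB.
  exact: GM GB.
have mlev f q : A f -> measurable [set w | ((ratr q)%:E < f w)%E].
  move=> /mA mf; rewrite -[X in measurable X]setTI.
  have -> : [set w | ((ratr q)%:E < f w)%E] = f @^-1` `](ratr q)%:E, +oo[%classic.
    by apply/seteqP; split => w /=; rewrite in_itv/= andbT.
  by apply: mf => //; exact: emeasurable_itv.
have msup s q : (forall n, A (s n)) -> measurable (superlevel s q).
  by move=> As; apply: bigcup_measurable => n _; exact: mlev.
have max q : exists s, (forall n, A (s n)) /\ forall s', (forall n, A (s' n)) ->
    (P (superlevel s' q) <= P (superlevel s q))%E.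
  pose B := [set P (superlevel s q) | s in [set s | forall n, A (s n)]].
  have B0 : B (P (superlevel (fun=> f0) q)) by exists (fun=> f0).
  have Bfin : ereal_sup B \is a fin_num.
    rewrite ge0_fin_numE.
      apply: (@le_lt_trans _ _ 1%E); last by rewrite ltry.
      by apply: ge_ereal_sup => _ [s As <-]; apply: probability_le1; exact: msup.
    by apply: le_trans (ereal_sup_ubound B0); exact: measure_ge0.
  have near k : exists s, (forall n, A (s n)) /\
      (ereal_sup B - (k.+1%:R^-1)%:E < P (superlevel s q))%E.
    have k0 : 0 < k.+1%:R^-1 :> R by rewrite invr_gt0.
    by have [_ [s As <-] ?] := ub_ereal_sup_adherent k0 Bfin; exists s.
  have [g gP] := choice near.
  have Ag : forall n, A (flatten g f0 n).
    by apply: flatten_in => // i j; exact: (gP i).1.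
  exists (flatten g f0); split => // s' As'.
  have s'B : (P (superlevel s' q) <= ereal_sup B)%E.
    by apply: ereal_sup_ubound; exists s'.
  apply: (le_trans s'B); apply/lee_addgt0Pr => e e0.
  have [k ke] : exists k, k.+1%:R^-1 < e.
    by exists (Num.truncn e^-1); rewrite invf_plt ?posrE// truncnS_gt.
  rewrite -leeBlDr//; apply: (@le_trans _ _ (P (superlevel (g k) q))).
    apply: ltW; apply: le_lt_trans (gP k).2.
    by apply: leeB => //; rewrite lee_fin ltW.
  apply: le_measure; rewrite ?inE; [exact/msup/(gP k).1|exact: msup|].
  by move=> w [n _ nw]; exists (pickle (k, n)) => //=; rewrite flattenE.
have [g gP] := choice max.
pose s := flatten g f0.
have As : forall n, A (s n) by apply: flatten_in => // i j; exact: (gP i).1.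
have maxs q s' : (forall n, A (s' n)) ->
    (P (superlevel s' q) <= P (superlevel s q))%E.
  move=> /((gP q).2 _) /le_trans; apply.
  apply: le_measure; rewrite ?inE; [exact/msup/(gP q).1|exact: msup|].
  by move=> w [n _ nw]; exists (pickle (q, n)) => //=; rewrite /s flattenE.
exists (fun w => esups (s ^~ w) 0%N); split.
- by apply: measurable_fun_esups => n; exact: AG.
- move=> f Af.
  pose s' n := if n is n'.+1 then s n' else f.
  have As' n : A (s' n) by case: n.
  have : forall n : nat, \forall w \ae P, forall q, unpickle n = Some q ->
      ((ratr q)%:E < f w)%E -> superlevel s q w.
    move=> n; case: (unpickle n) => [q|]; last by apply: aeW.
    exists (superlevel s' q `\` superlevel s q); split.
    + by apply: measurableD; exact: msup.
    + have ss' : superlevel s q `<=` superlevel s' q.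
        by move=> w [k _ kw]; exists k.+1.
      rewrite measureD ?ltey_eq ?fin_num_measure//; try exact: msup.
      rewrite setIidr//; apply/eqP; rewrite eq_le sube_le0 maxs//=.
      rewrite sube_ge0 ?fin_num_measure//; try exact: msup.
      by apply: le_measure => //; rewrite inE; exact: msup.
    + move=> w /= /existsNP[q'] /not_implyP[[<-]] /not_implyP[fw nw].
      by split=> //; exists 0%N.
  move/ae_foralln; apply: filterS => w Hw.
  rewrite leNgt; apply/negP => /rat_between[q /andP[Sq qf]].
  have [n _ /= nw] := Hw (pickle q) q (pickleK q) qf.
  have : (s n w <= esups (s ^~ w) 0%N)%E by apply: ereal_sup_ubound; exists n.
  by rewrite leNgt (lt_trans Sq nw).
- move=> S' _ ubS'.
  have /ae_foralln : forall n, \forall w \ae P, (s n w <= S' w)%E.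
    by move=> n; exact: ubS'.
  by apply: filterS => w Hw; apply: ge_ereal_sup => _ [n _ <-].
Qed.

End random_variables.

Section model.
Context {R : realType} {dO : measure_display} {Omega : measurableType dO}.
Variables (P : probability Omega R) (d : nat).
Local Notation L0 := (@L0 R dO Omega).
Local Notation L0vec := (@L0vec R dO Omega d).
Local Notation L0low := (L0low P).

Definition filtration (T : nat) (F : nat -> set (set Omega)) : Prop :=
  [/\ forall t, (t <= T)%N -> sigma_algebra setT (F t),
      forall t, (t < T)%N -> F t `<=` F t.+1 &
      F T = measurable].

(* In the two records, G stands for F_t and H for F_{t+1}. *)
Record wealth_map (G H : set (set Omega))
    (v : (Omega -> R) -> (Omega -> 'rV[R]_d) -> Omega -> R) : Prop := {
  wealth_L0 : forall x z, L0 G x -> L0vec G z -> L0 H (v x z);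
  wealth_stable : forall A x_ z_, cpartition G A ->
    (forall k, L0 G (x_ k)) -> (forall k, L0vec G (z_ k)) ->
    v (concat A x_) (concat A z_) = concat A (fun k => v (x_ k) (z_ k)) %[ae P];
  wealth_cont : forall x_ z_ x z,
    (forall k, L0 G (x_ k)) -> (forall k, L0vec G (z_ k)) ->
    L0 G x -> L0vec G z -> cvg_as P x_ x -> cvgvec_as P z_ z ->
    cvg_as P (fun k => v (x_ k) (z_ k)) (v x z);
  wealth_incr : forall x x' z, L0 G x -> L0 G x' -> L0vec G z ->
    (\forall w \ae P, x w <= x' w) -> \forall w \ae P, v x z w <= v x' z w;
  wealth_concave : forall x z z' l, L0 G x -> L0vec G z -> L0vec G z' -> L0 G l ->
    (\forall w \ae P, 0 <= l w <= 1) ->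
    \forall w \ae P, l w * v x z w + (1 - l w) * v x z' w <=
      v x (fun w' => l w' *: z w' + (1 - l w') *: z' w') w;
  wealth_loss : forall x z p, L0 G x -> L0vec G z ->
    is_cond_prob P G [set w | v x z w < x w] p ->
    \forall w \ae P, z w != 0 -> 0 < p w;
  wealth_zero : forall x, L0 G x -> v x (cst 0) = x %[ae P]
}.

Local Open Scope ereal_scope.

(* [mule] satisfies the convention 0 * -oo = 0. *)
Record utility_map (G H : set (set Omega))
    (u : (Omega -> R) -> (Omega -> \bar R) -> (Omega -> 'rV[R]_d) ->
         Omega -> \bar R) : Prop := {
  utility_L0 : forall x y z, L0 G x -> L0low H y -> L0vec G z -> L0low G (u x y z);
  utility_stable : forall A x_ y_ z_, cpartition G A -> (forall k, L0 G (x_ k)) ->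
    (forall k, L0low H (y_ k)) -> (forall k, L0vec G (z_ k)) ->
    u (concat A x_) (concat A y_) (concat A z_) =
      concat A (fun k => u (x_ k) (y_ k) (z_ k)) %[ae P];
  utility_incr_fst : forall x x' y z, L0 G x -> L0 G x' -> L0low H y -> L0vec G z ->
    (\forall w \ae P, (x w <= x' w)%R) ->
    \forall w \ae P, u x y z w <= u x' y z w;
  utility_incr_snd : forall x y y' z, L0 G x -> L0low H y -> L0low H y' -> L0vec G z ->
    (\forall w \ae P, y w <= y' w) ->
    \forall w \ae P, u x y z w <= u x y' z w;
  utility_usc : forall x_ y_ z_ x y z, (forall k, L0 G (x_ k)) ->
    (forall k, L0low H (y_ k)) -> (forall k, L0vec G (z_ k)) ->
    L0 G x -> L0low H y -> L0vec G z ->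
    cvg_as P x_ x -> cvge_as P y_ y -> cvgvec_as P z_ z ->
    \forall w \ae P,
      limn_esup (fun k => u (x_ k) (y_ k) (z_ k) w) <= u x y z w;
  utility_quasiconcave : forall x y y' z z' l, L0 G x -> L0low H y -> L0low H y' ->
    L0vec G z -> L0vec G z' -> L0 G l ->
    (\forall w \ae P, (0 <= l w <= 1)%R) ->
    \forall w \ae P, Order.min (u x y z w) (u x y' z' w) <=
      u x (fun w' => (l w')%:E * y w' + (1 - l w')%:E * y' w')
          (fun w' => (l w' *: z w' + (1 - l w') *: z' w')%R) w;
  utility_translation : forall x y z c, L0 G x -> L0low H y -> L0vec G z -> L0 G c ->
    u x (fun w => y w + (c w)%:E) z = (fun w => u x y z w + (c w)%:E) %[ae P];
  utility_coercive : forall x y z p, L0 G x -> L0low H y -> L0vec G z ->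
    is_cond_prob P G [set w | y w < 0] p ->
    \forall w \ae P, (0 < p w)%R ->
      u x (fun w' => m%:R%:E * y w') (fun w' => (m%:R *: z w')%R) w
        @[m --> \oo] --> -oo;
  utility_zero : forall x, L0 G x -> u x (cst 0) (cst 0%R) = cst 0 %[ae P]
}.

Variables (T : nat) (F : nat -> set (set Omega)).
Variable v : nat -> (Omega -> R) -> (Omega -> 'rV[R]_d) -> Omega -> R.
Variable u : nat -> (Omega -> R) -> (Omega -> \bar R) ->
  (Omega -> 'rV[R]_d) -> Omega -> \bar R.

(* The set C_t(x); a process is a pair of sequences, of which only the entries
   x_t, ..., x_T (with x_t = x) and z_t, ..., z_{T-1} matter. *)
Definition attainable (t : nat) (x : Omega -> R) :
    set ((nat -> Omega -> R) * (nat -> Omega -> 'rV[R]_d)) :=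
  [set p | [/\ p.1 t = x %[ae P],
    forall s, (t <= s <= T)%N -> L0 (F s) (p.1 s) &
    forall s, (t <= s < T)%N ->
      L0vec (F s) (p.2 s) /\ p.1 s.+1 = v s (p.1 s) (p.2 s) %[ae P]]].

(* [compose x z t n] is
   u_t(x_t, ., z_t) o ... o u_{t+n-1}(x_{t+n-1}, ., z_{t+n-1}) (x_{t+n}). *)
Fixpoint compose (x : nat -> Omega -> R) (z : nat -> Omega -> 'rV[R]_d)
    (t n : nat) : Omega -> \bar R :=
  if n is n'.+1 then u t (x t) (compose x z t.+1 n') (z t) else EFin \o x t.

Definition value (t : nat) (x : Omega -> R) : Omega -> \bar R :=
  if (t < T)%N then
    esssup P (F t) [set compose p.1 p.2 t (T - t) | p in attainable t x]
  else EFin \o x.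

Definition one_step (t : nat) (x : Omega -> R) (z : Omega -> 'rV[R]_d) :
    Omega -> \bar R :=
  u t x (value t.+1 (v t x z)) z.

End model.

(* Main.v *)
(* The recursion is proved backwards in time. Write Y for y_(t+1), and
   f(x, z) = u_t(x, Y(v_t(x, z)), z), g(x, z) = u_t(x, v_t(x, z), z). The
   induction carries, besides stability, monotonicity and upper semicontinuity
   of Y, a bound Y(x) <= x + C, so that f <= g + C.

   Superlevel sets of g(x, .) are bounded: g is quasi-concave in z with
   g(x, 0) = x, so along an unbounded sequence z_k with g(x, z_k) >= c the
   normalized vectors have a limit point z with |z| = 1 and
   g(x, m z) >= min(c, x) for all m; concavity of v_t gives
   v_t(x, m z) <= m (v_t(x, z) - x) + x, and (v5), (u5), (u6) then force
   g(x, m z) -> -oo.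

   Hence, if x_k -> x, a measurable choice of indices along which f(x_k, z_k)
   approaches its limsup gives a bounded sequence of vectors, and a measurable
   Bolzano-Weierstrass argument yields z with limsup f(x_k, z_k) <= f(x, z).
   With x_k = x and z_k almost maximizing this gives the existence of a
   maximizer; with z_k a maximizer for x_k it gives the upper semicontinuity of
   x |-> max_z f(x, z). *)

Require Import Defs.
From HB Require Import structures.
From mathcomp Require Import all_boot all_order all_algebra.
From mathcomp Require Import all_classical all_reals all_analysis measurable_realfun.
From mathcomp Require Import lra.

Set Implicit Arguments.
Unset Strict Implicit.
Unset Printing Implicit Defensive.
Import Order.TTheory GRing.Theory Num.Theory.
Import numFieldNormedType.Exports.
Local Open Scope classical_set_scope.
Local Open Scope ring_scope.

(** * Order characterization of the limit superior in the extended reals *)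

Section limsup.
Context {R : realType}.
Implicit Types (a b : (\bar R)^nat) (c l : \bar R).
Local Open Scope ereal_scope.

(** The extended reals are densely ordered: take the midpoint after transporting both ends into
    [-1, 1] by [contract]. *)
Let between l c : l < c -> exists e, l < e < c.
Proof.
move=> lc; have := lc; rewrite -lt_contract => /midf_lt[lm mc].
set m := ((contract l + contract c) / 2)%R in lm mc.
have m1 : m \in [pred r | `|r| <= 1]%R.
  rewrite inE ler_norml; have := contract_le1 l; have := contract_le1 c.
  rewrite !ler_norml => /andP[_ c1] /andP[l1 _].
  by rewrite (le_trans l1 (ltW lm)) (le_trans (ltW mc) c1).
by exists (expand m); rewrite -!lt_contract expandK// lm mc.
Qed.

(** Testing against every c > l, rather than against l + e, treats finite and infinite l alike. *)
Lemma limn_esup_leP a l :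
  (forall c, l < c -> \forall n \near \oo, a n <= c) <-> limn_esup a <= l.
Proof.
split=> [al|al c lc].
  rewrite leNgt; apply/negP => /between[c /andP[lc ca]].
  have [N _ aN] := al c lc.
  move: ca; rewrite ltNge => /negP; apply.
  rewrite /limn_esup limf_esupE; apply: (@le_trans _ _ (ereal_sup (a @` [set n | (N <= n)%N]))).
    by apply: ereal_inf_lbound; exists [set n | (N <= n)%N] => //; exists N.
  by apply: ge_ereal_sup => _ [n /= Nn <-]; exact: aN.
have : limn_esup a < c by exact: le_lt_trans lc.
rewrite /limn_esup limf_esupE => /ereal_inf_lt[_ [V VF <-]] Vc.
apply: filterS VF => n Vn; apply: le_trans (ltW Vc).
by apply: ereal_sup_ubound; exists n.
Qed.

Lemma le_limn_esup a b : (\forall n \near \oo, a n <= b n) ->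
  limn_esup a <= limn_esup b.
Proof.
move=> ab; apply/limn_esup_leP => c bc.
have := (limn_esup_leP b _).2 (lexx _) c bc.
by move: ab; apply: filterS2 => n; exact: le_trans.
Qed.

Lemma limn_esup_gt_frequently a c : c < limn_esup a ->
  forall n, exists2 k, (n <= k)%N & c < a k.
Proof.
move=> ca n; apply: contrapT => /forall2NP h.
move: ca; rewrite ltNge => /negP; apply; apply/limn_esup_leP => e ce.
exists n => // k /= nk; have [//|/negP] := h k.
by rewrite -leNgt => /le_trans; apply; exact: ltW.
Qed.

Lemma limn_esup_cst_le a l : (forall n, l <= a n) -> l <= limn_esup a.
Proof.
move=> la; rewrite /limn_esup limf_esupE; apply: le_ereal_inf_tmp => _ [V [N _ NV] <-].
by apply: le_trans (la N) _; apply: ereal_sup_ubound; exists N => //; apply: NV => /=.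
Qed.

End limsup.

(** * Measurable random indices *)

Section random_index.
Context d (T : measurableType d).

Lemma measurable_reindex d' (S : measurableType d') (theta : T -> nat)
    (f : nat -> T -> S) :
  (forall k, measurable (theta @^-1` [set k])) ->
  (forall k, measurable_fun setT (f k)) ->
  measurable_fun setT (fun w => f (theta w) w).
Proof.
move=> mtheta mf _ B mB; rewrite setTI.
have -> : (fun w => f (theta w) w) @^-1` B =
    \bigcup_k (theta @^-1` [set k] `&` f k @^-1` B).
  apply/seteqP; split=> [w /= Bw|w [k _ /= [<-]]//].
  by exists (theta w).
apply: bigcup_measurable => k _; apply: measurableI => //.
by rewrite -[X in measurable X]setTI; exact: mf.
Qed.

(** [theta n w] is the least k >= n with w in [E n k]. Its level sets are [E n k] minus finitely
    many earlier [E n j], hence measurable. *)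
Lemma measurable_first (E : nat -> nat -> set T) :
  (forall n k, measurable (E n k)) ->
  (forall n w, exists2 k, (n <= k)%N & E n k w) ->
  exists theta : nat -> T -> nat,
    [/\ forall n k, measurable (theta n @^-1` [set k]),
        forall n w, (n <= theta n w)%N &
        forall n w, E n (theta n w) w].
Proof.
move=> mE Ex.
have Ex' n w : exists k, (n <= k)%N && `[< E n k w >].
  by have [k nk Ek] := Ex n w; exists k; rewrite nk; exact/asboolP.
pose theta n w := ex_minn (Ex' n w).
exists theta; split=> [n k|n w|n w].
- have -> : theta n @^-1` [set k] = [set w | (n <= k)%N /\ E n k w] `&`
     \bigcap_(j in [set j | (n <= j < k)%N]) ~` E n j.
    apply/seteqP; split=> [w|w [[/= nk Ek] nE]] /=.
      rewrite /theta; case: ex_minnP => m /andP[nm /asboolP Em] min <-.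
      split=> // j /= /andP[nj jm] Ej.
      have := min j; rewrite nj/= => /(_ (introT (asboolP _) Ej)).
      by rewrite leqNgt jm.
    rewrite /theta; case: ex_minnP => m /andP[nm /asboolP Em] min.
    apply/eqP; rewrite eqn_leq min ?nk ?(introT (asboolP _))//= leqNgt.
    by apply/negP => mk; apply: (nE m) => //=; rewrite nm.
  apply: measurableI; last by apply: bigcap_measurableType => j _; exact: measurableC.
  have [nk|nk] := leqP n k.
    by rewrite (_ : [set _ | _] = E n k)//; apply/seteqP; split=> // w [].
  by rewrite (_ : [set _ | _] = set0)//; apply/seteqP; split=> // w [].
- by rewrite /theta; case: ex_minnP => m /andP[].
- by rewrite /theta; case: ex_minnP => m /andP[_ /asboolP].
Qed.

End random_index.

(** * Measurable Bolzano-Weierstrass selection *)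

Section bolzano_weierstrass.
Context {R : realType} d (T : measurableType d).

Lemma cvg_dist_inv (a : nat -> R) (l : R) :
  (forall n, `|l - a n| <= n.+1%:R^-1) -> a @ \oo --> l.
Proof.
move=> al; apply/cvgrPdist_le => e e0.
have := near_infty_natSinv_lt (PosNum e0); apply: filterS => n /= ne.
exact: le_trans (al n) (ltW ne).
Qed.

(** The condition n <= s n already sends s to infinity; this is the form in which [measurable_first]
    controls its indices. *)
Lemma cvg_reindex_ge (V : topologicalType) (a : nat -> V) (l : V) (s : nat -> nat) :
  (forall n, (n <= s n)%N) -> a @ \oo --> l -> (fun n => a (s n)) @ \oo --> l.
Proof.
move=> ns al; apply: (cvg_comp s a _ al).
by move=> A [N _ NA]; exists N => // n /= Nn; apply: NA => /=; exact: leq_trans (ns n).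
Qed.

(** The limit is the limsup S, finite by boundedness. Terms are eventually below S + 1/(n+1) and
    infinitely often above S - 1/(n+1), so some index >= n is within 1/(n+1) of S, and [theta n]
    takes the first one. *)
Lemma random_bolzano_weierstrass_scalar (r : nat -> T -> R) :
  (forall n, measurable_fun setT (r n)) ->
  (forall w, exists M, forall n, `|r n w| <= M) ->
  exists (theta : nat -> T -> nat) (l : T -> R),
    [/\ forall n k, measurable (theta n @^-1` [set k]),
        forall n w, (n <= theta n w)%N,
        measurable_fun setT l &
        forall w, r (theta n w) w @[n --> \oo] --> l w].
Proof.
move=> mr rM.
pose S w := limn_esup (fun n => (r n w)%:E).
have mS : measurable_fun setT S.
  by apply: measurable_fun_limn_esup => n; exact/measurable_EFinP.
have Sfin w : S w \is a fin_num.
  have [M Mr] := rM w; rewrite fin_real//; apply/andP; split.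
    apply: (@lt_le_trans _ _ (- M)%:E); first exact: ltNyr.
    apply: limn_esup_cst_le => n; rewrite lee_fin.
    by have := Mr n; rewrite ler_norml => /andP[].
  apply: (@le_lt_trans _ _ M%:E); last exact: ltry.
  apply/limn_esup_leP => c Mc; apply: nearW => n; apply: le_trans (ltW Mc).
  by rewrite lee_fin; have := Mr n; rewrite ler_norml => /andP[].
have ml : measurable_fun setT (fine \o S) by exact: measurableT_comp.
pose E n k := [set w | `|fine (S w) - r k w| <= n.+1%:R^-1].
have mE n k : measurable (E n k).
  rewrite (_ : E n k = (fun w => `|fine (S w) - r k w|) @^-1` `]-oo, n.+1%:R^-1]).
    rewrite -[X in measurable X]setTI; apply: measurableT_comp => //.
      exact: measurable_funB.
  by apply/seteqP; split=> w /=; rewrite in_itv.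
have [n w|theta [mtheta ntheta Etheta]] := measurable_first mE.
  have e0 : 0 < n.+1%:R^-1 :> R by rewrite invr_gt0.
  have : (S w < S w + (n.+1%:R^-1)%:E)%E by rewrite lteDl.
  move/((limn_esup_leP _ _).2 (lexx (S w))) => [N _ hN].
  have : (S w - (n.+1%:R^-1)%:E < S w)%E by rewrite lteBlDr// lteDl.
  move/limn_esup_gt_frequently => /(_ (maxn n N))[k]; rewrite geq_max => /andP[nk Nk] kS.
  exists k => //; rewrite /E/=; have := hN k Nk; move: kS.
  rewrite -(fineK (Sfin w)) -EFinD -?EFinB lte_fin lee_fin => h1 h2.
  by rewrite ler_distlC h2 (ltW h1).
exists theta, (fine \o S); split=> // w; apply: cvg_dist_inv => n; exact: Etheta.
Qed.

(** Coordinates are treated one after another: the index that makes the first k of them converge is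
    composed with one that makes coordinate k converge, which leaves the earlier limits
    unchanged. *)
Lemma random_bolzano_weierstrass p (Z : nat -> T -> 'rV[R]_p) :
  (forall n i, measurable_fun setT (fun w => Z n w ord0 i)) ->
  (forall w i, exists M, forall n, `|Z n w ord0 i| <= M) ->
  exists (theta : nat -> T -> nat) (z : T -> 'rV[R]_p),
    [/\ forall n k, measurable (theta n @^-1` [set k]),
        forall n w, (n <= theta n w)%N,
        forall i, measurable_fun setT (fun w => z w ord0 i) &
        forall w i, Z (theta n w) w ord0 i @[n --> \oo] --> z w ord0 i].
Proof.
move=> mZ ZM.
(* The condition i < m stands under the existential, so that for m = p [choice] gives the limits of
   all coordinates at once. *)
suff /(_ p (leqnn p))[theta [mtheta ntheta /choice[z zP]]] :
  forall m, (m <= p)%N -> exists theta : nat -> T -> nat,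
   [/\ forall n k, measurable (theta n @^-1` [set k]),
       forall n w, (n <= theta n w)%N &
       forall i : 'I_p, exists l : T -> R,
         (i < m)%N -> measurable_fun setT l /\
         forall w, Z (theta n w) w ord0 i @[n --> \oo] --> l w].
  exists theta, (fun w => \row_i z i w); split=> // [i|w i].
    by rewrite (_ : (fun w => _) = z i); [exact: (zP i _).1|apply/funext => w; rewrite mxE].
  by rewrite mxE; exact: (zP i _).2.
elim=> [_|k IH kp].
  exists (fun n _ => n); split=> // [n k|i]; last by exists (cst 0).
  have [->|nk] := eqVneq n k; first by rewrite preimage_cst mem_set.
  by rewrite preimage_cst memNset//; exact/eqP.
have [theta [mtheta ntheta zP]] := IH (ltnW kp).
pose j := Ordinal kp.
have [n|w|sigma [l [msigma nsigma ml rl]]] :=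
    @random_bolzano_weierstrass_scalar (fun n w => Z (theta n w) w ord0 j).
- exact: (measurable_reindex (f := fun k w => Z k w ord0 j) (mtheta n)).
- by have [M ZMw] := ZM w j; exists M => n; exact: ZMw.
exists (fun n w => theta (sigma n w) w); split.
- move=> n i.
  have := @measurable_reindex _ _ _ nat (sigma n) theta (msigma n) _ measurableT [set i].
  rewrite setTI; apply => // m _ B _; rewrite setTI.
  have -> : theta m @^-1` B = \bigcup_(i in B) theta m @^-1` [set i].
    by apply/seteqP; split=> [w Bw|w [? ? /= ->]]//; exists (theta m w).
  exact: bigcup_measurable.
- by move=> n w; exact: leq_trans (ntheta _ _).
- move=> i; have [ik|ki|ik] := ltngtP i k.
  + have [li /(_ ik)[mli cli]] := zP i; exists li => _; split=> // w.
    exact: (@cvg_reindex_ge _ (fun n => Z (theta n w) w ord0 i) _ (fun n => sigma n w)).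
  + by exists (cst 0); rewrite ltnS leqNgt ki.
  + exists l => _; split=> //; have -> : i = j by exact/val_inj.
    exact: rl.
Qed.

End bolzano_weierstrass.

(** * Sub-sigma-algebras and existence of conditional probabilities *)

Section sub_sigma_algebra.
Context {R : realType} {dO : measure_display} {Omega : measurableType dO}.
Variables (P : probability Omega R) (G : set (set Omega)).
Hypotheses (sG : sigma_algebra setT G) (GM : G `<=` measurable).

Lemma sub_sigmaP (A : set Omega) : measurable (A : set (g_sigma_algebraType G)) <-> G A.
Proof. by rewrite /measurable/= sigma_algebra_id. Qed.

Lemma sub_measurableW d' (S : measurableType d') (f : Omega -> S) :
  sub_measurable G f -> measurable_fun setT f.
Proof.
move=> mf _ B mB; have := mf measurableT B mB.
by rewrite !setTI => /sub_sigmaP; exact: GM.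
Qed.

(** p is the Radon-Nikodym derivative of the measure sending A to the probability of A and E, with
    respect to P on G. Both become measures on G by pushing forward along the identity into
    [g_sigma_algebraType G]. *)
Lemma exists_cond_prob (E : set Omega) : measurable E ->
  exists p, is_cond_prob P G E p.
Proof.
move=> mE; pose GT := g_sigma_algebraType G.
have mid : measurable_fun setT (idfun : Omega -> GT).
  by move=> _ B /sub_sigmaP/GM; rewrite setTI.
pose X : {mfun Omega >-> GT} := HB.pack (idfun : Omega -> GT)
  (isMeasurableFun.Build _ _ _ _ _ mid).
pose PG := distribution P X.
have [nu0 nu0E] : exists nu0 : {measure set GT -> \bar R},
    forall A : set GT, nu0 A = P (A `&` E).
  by unshelve eexists (pushforward (mrestr P mE) X).
have nu0T : (nu0 setT < +oo)%E by rewrite nu0E setTI ltey_eq fin_num_measure.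
pose nu := mfrestr (@measurableT _ GT) nu0T.
have nuE A : nu A = P (A `&` E) by rewrite /nu /mfrestr /mrestr setIT nu0E.
have dom : nu `<< PG.
  apply/null_content_dominatesP => A mA PA0.
  have mA' : measurable (A : set Omega) by exact/GM/sub_sigmaP.
  by rewrite nuE; exact: (subset_measure0 (measurableI _ _ mA' mE) mA' _ PA0).
have [f [ffin intf fE]] : exists f : GT -> \bar R, [/\ (forall x, f x \is a fin_num),
    PG.-integrable [set: GT] f &
    forall A, measurable A -> (nu A = \int[PG]_(x in A) f x)%E].
  by have [f [_ *]] := radon_nikodym_sigma_finite dom; exists f.
have mf : measurable_fun setT f by exact: measurable_int intf.
have intPf : P.-integrable setT (f \o X).
  apply/integrableP; split; first exact: measurableT_comp.
  have /integrableP[_] := intf.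
  by rewrite /PG /distribution ge0_integral_pushforward//; exact: measurableT_comp.
exists (fine \o f); split.
- exact: measurableT_comp.
- apply: eq_integrable intPf => // x _ /=.
  by rewrite fineK.
- move=> A /sub_sigmaP mA.
  transitivity (\int[P]_(x in X @^-1` A) (f \o X) x)%E.
    by apply: eq_integral => x _ /=; rewrite fineK.
  rewrite -integral_pushforward//; last first.
    by apply: integrableS intPf => //; exact/GM/sub_sigmaP.
  by rewrite setIC -nuE fE.
Qed.

End sub_sigma_algebra.

(** * Concatenation as composition with a random index *)

Section random_index_stability.
Context {R : realType} {dO : measure_display} {Omega : measurableType dO}.
Variables (P : probability Omega R) (G : set (set Omega)).
Hypotheses (sG : sigma_algebra setT G).

(* A countable partition is encoded by the index theta of the block containing w;
   concatenation along it is composition with theta. *)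
Definition random_index (theta : Omega -> nat) := forall k, G (theta @^-1` [set k]).

Lemma cpartition_random_index theta : random_index theta ->
  cpartition G (fun k => theta @^-1` [set k]).
Proof.
move=> mtheta; split=> //.
- by apply/trivIsetP => i j _ _ ij; rewrite -preimage_setI; apply/seteqP; split=> // w [/= ->];
    exact/eqP.
- by apply/seteqP; split=> // w _; exists (theta w).
Qed.

Lemma concat_random_index V theta (x_ : nat -> Omega -> V) :
  concat (fun k => theta @^-1` [set k]) x_ = fun w => x_ (theta w) w.
Proof.
apply/funext => w; rewrite /concat; congr (x_ _ w).
by apply: xget_unique => // k /= <-.
Qed.

Lemma random_index_cpartition A : cpartition G A -> exists2 theta, random_index theta &
  forall V (x_ : nat -> Omega -> V), concat A x_ = fun w => x_ (theta w) w.
Proof.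
case=> GA tA UA; exists (fun w => xget 0%N [set k | A k w]) => // k.
rewrite (_ : _ @^-1` _ = A k)//; apply/seteqP; split=> w /=.
  have [j _ Aj] : (\bigcup_k A k) w by rewrite UA.
  by case: xgetP => [i _ Ai <-//|/(_ j)].
move=> Ak; apply: xget_unique => // j Aj.
by apply: (tA j k) => //; exists w.
Qed.

Lemma random_index_sub theta :
  random_index theta <-> forall k, measurable (theta @^-1` [set k] : set (g_sigma_algebraType G)).
Proof. by split=> h k; have := h k; rewrite sub_sigmaP. Qed.

Lemma sub_measurable_reindex theta d' (S : measurableType d') (f : nat -> Omega -> S) :
  random_index theta -> (forall k, sub_measurable G (f k)) ->
  sub_measurable G (fun w => f (theta w) w).
Proof. by move=> /random_index_sub; exact: measurable_reindex. Qed.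

Lemma L0_reindex theta (x_ : nat -> Omega -> R) : random_index theta ->
  (forall k, L0 G (x_ k)) -> L0 G (fun w => x_ (theta w) w).
Proof. exact: sub_measurable_reindex. Qed.

Lemma L0vec_reindex d theta (z_ : nat -> Omega -> 'rV[R]_d) : random_index theta ->
  (forall k, L0vec G (z_ k)) -> L0vec G (fun w => z_ (theta w) w).
Proof.
move=> ? Lz i; apply: (@sub_measurable_reindex _ _ _ (fun k w => z_ k w ord0 i)) => // k.
exact: Lz.
Qed.

Lemma L0low_reindex theta (y_ : nat -> Omega -> \bar R) : random_index theta ->
  (forall k, L0low P G (y_ k)) -> L0low P G (fun w => y_ (theta w) w).
Proof.
move=> mtheta Ly; split.
  by apply: sub_measurable_reindex => // k; exact: (Ly k).1.
have /ae_foralln : forall k, \forall w \ae P, (y_ k w < +oo)%E by move=> k; exact: (Ly k).2.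
by apply: filterS => w; exact.
Qed.

(** A boolean read as a number: 0 on B and 1 off B. Pasting two maps along B is thus reindexing with
    two nonempty blocks at most. *)
Definition paste_index (B : set Omega) (w : Omega) : nat := (w \notin B).

Lemma random_paste_index B : G B -> random_index (paste_index B).
Proof.
have [G0 GC GU] := sG.
move=> GB [|[|k]].
- rewrite (_ : _ @^-1` _ = B)//; apply/seteqP; split=> w /=; rewrite /paste_index.
    by have [/set_mem//|] := boolP (w \in B).
  by move=> /mem_set ->.
- rewrite (_ : _ @^-1` _ = ~` B); first by rewrite -setTD; exact: GC.
  apply/seteqP; split=> w /=; rewrite /paste_index.
    by have [//|/negP nB _ /mem_set] := boolP (w \in B).
  by move=> nB; rewrite memNset.
- rewrite (_ : _ @^-1` _ = set0)//; apply/seteqP; split=> w //=.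
  by rewrite /paste_index; case: (_ \notin _).
Qed.

Lemma sub_measurable_paste d' (S : measurableType d') (f f' : Omega -> S) B : G B ->
  sub_measurable G f -> sub_measurable G f' ->
  sub_measurable G (fun w => if w \in B then f w else f' w).
Proof.
move=> GB mf mf'.
have := @sub_measurable_reindex (paste_index B) _ _ (fun k => if k is 0%N then f else f')
  (random_paste_index GB).
rewrite (_ : (fun w => _) = (fun w => if w \in B then f w else f' w)); last first.
  by apply/funext => w; rewrite /paste_index; case: (w \in B).
by apply => -[].
Qed.

Lemma L0vec_paste d (z z' : Omega -> 'rV[R]_d) B : G B -> L0vec G z -> L0vec G z' ->
  L0vec G (fun w => if w \in B then z w else z' w).
Proof.
move=> GB Lz Lz' i.
have := sub_measurable_paste GB (Lz i) (Lz' i); congr (sub_measurable G _).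
by apply/funext => w; case: ifP.
Qed.

Lemma ae_eq_setTP V (f g : Omega -> V) : f = g %[ae P] <-> \forall w \ae P, f w = g w.
Proof. by split; apply: filterS => w // ->. Qed.

(** Monotonicity in both directions makes f independent of the representative. *)
Lemma increasing1_congr f x x' : increasing1 P G f -> L0 G x -> L0 G x' ->
  (\forall w \ae P, x w = x' w) -> \forall w \ae P, f x w = f x' w.
Proof.
move=> fi Lx Lx' xx'.
have /(fi _ _ Lx Lx') : \forall w \ae P, x w <= x' w by apply: filterS xx' => w ->.
have /(fi _ _ Lx' Lx) : \forall w \ae P, x' w <= x w by apply: filterS xx' => w ->.
by apply: filterS2 => w ge le; apply/eqP; rewrite eq_le le.
Qed.

Lemma stable1_reindex f theta x_ : stable1 P G f -> random_index theta ->
  (forall k, L0 G (x_ k)) ->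
  \forall w \ae P, f (fun w => x_ (theta w) w) w = f (x_ (theta w)) w.
Proof.
move=> fs mtheta Lx; have := fs _ _ (cpartition_random_index mtheta) Lx.
by rewrite !concat_random_index => /ae_eq_setTP.
Qed.

End random_index_stability.

(** * The one-step objective and the properties it inherits *)

Section one_step_map.
Context {R : realType} {dO : measure_display} {Omega : measurableType dO}.
Variables (P : probability Omega R) (d : nat) (G H : set (set Omega)).
Hypotheses (sG : sigma_algebra setT G) (sH : sigma_algebra setT H).
Hypotheses (GH : G `<=` H) (HM : H `<=` measurable).

(** The regularity of value functions that is passed on from time t+1 to time t. *)
Definition admissible (K : set (set Omega)) (Y : (Omega -> R) -> Omega -> \bar R) :=
  [/\ forall x, L0 K x -> L0low P K (Y x), stable1 P K Y,
      increasing1 P K Y & seq_usc1 P K Y].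

Lemma L0low_EFin (x : Omega -> R) : L0 H x -> L0low P H (EFin \o x).
Proof.
by move=> Lx; split; [exact/measurable_EFinP|apply: aeW => w; rewrite /= ltry].
Qed.

(** This is y_T, the start of the induction; it also makes the facts on [objective] available for
    Y(x) = x. *)
Lemma admissible_EFin : admissible H (fun x => EFin \o x).
Proof.
split.
- exact: L0low_EFin.
- by move=> A x_ cA Lx; apply: aeW => w _; rewrite /concat.
- by move=> x x' _ _; apply: filterS => w /=; rewrite lee_fin.
- move=> x_ x _ _; apply: filterS => w xx.
  have /cvg_limn_einf_sup[_ ->//] : (x_ k w)%:E @[k --> \oo] --> (x w)%:E.
  by apply: cvg_EFin => //; exact: nearW.
Qed.

Lemma sub_measurableS d' (S : measurableType d') (f : Omega -> S) :
  sub_measurable G f -> sub_measurable H f.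
Proof.
move=> mf _ B mB; have := mf measurableT B mB.
by rewrite !setTI => /(sub_sigmaP sG)/GH/(sub_sigmaP sH).
Qed.

Variables (v : (Omega -> R) -> (Omega -> 'rV[R]_d) -> Omega -> R)
  (u : (Omega -> R) -> (Omega -> \bar R) -> (Omega -> 'rV[R]_d) -> Omega -> \bar R).
Hypotheses (hv : wealth_map P G H v) (hu : utility_map P G H u).

Lemma utility_congr_snd x y y' z : L0 G x -> L0low P H y -> L0low P H y' -> L0vec G z ->
  (\forall w \ae P, y w = y' w) -> \forall w \ae P, u x y z w = u x y' z w.
Proof.
move=> Lx Ly Ly' Lz yy'.
have /(utility_incr_snd hu Lx Ly Ly' Lz) : \forall w \ae P, (y w <= y' w)%E.
  by apply: filterS yy' => w ->.
have /(utility_incr_snd hu Lx Ly' Ly Lz) : \forall w \ae P, (y' w <= y w)%E.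
  by apply: filterS yy' => w ->.
by apply: filterS2 => w ge le; apply/eqP; rewrite eq_le le.
Qed.

Section objective.
Variable Y : (Omega -> R) -> Omega -> \bar R.
Hypothesis hY : admissible H Y.

Definition objective x z : Omega -> \bar R := u x (Y (v x z)) z.

Lemma objective_low x z : L0 G x -> L0vec G z -> L0low P G (objective x z).
Proof.
case: hY => Ylow _ _ _ Lx Lz; apply: (utility_L0 hu) => //.
by apply: Ylow; exact: (wealth_L0 hv).
Qed.

(** Stability passes through v, then Y (a G-partition is an H-partition), then u. The inner
    identities hold only a.s., so each is carried through the outer maps by the congruences that
    monotonicity provides. *)
Lemma objective_reindex theta x_ z_ : random_index G theta ->
  (forall k, L0 G (x_ k)) -> (forall k, L0vec G (z_ k)) ->
  \forall w \ae P, objective (fun w => x_ (theta w) w) (fun w => z_ (theta w) w) w =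
    objective (x_ (theta w)) (z_ (theta w)) w.
Proof.
case: hY => Ylow Ys Yi _ mtheta Lx Lz; have cA := cpartition_random_index mtheta.
have mthetaH : random_index H theta by move=> k; exact/GH/mtheta.
set xt := fun w => x_ (theta w) w; set zt := fun w => z_ (theta w) w.
have Lxt : L0 G xt by exact: L0_reindex.
have Lzt : L0vec G zt by exact: L0vec_reindex.
pose v_ k := v (x_ k) (z_ k); pose y_ k := Y (v_ k).
have Lv k : L0 H (v_ k) by exact: (wealth_L0 hv).
have Lvt : L0 H (fun w => v_ (theta w) w) by exact: L0_reindex.
have Lvxt : L0 H (v xt zt) by exact: (wealth_L0 hv).
have Ly k : L0low P H (y_ k) by exact: Ylow.
have Lyt : L0low P H (fun w => y_ (theta w) w) by exact: L0low_reindex.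
have vE : \forall w \ae P, v xt zt w = v_ (theta w) w.
  by have := wealth_stable hv cA Lx Lz; rewrite !concat_random_index => /ae_eq_setTP.
have YE1 := increasing1_congr Yi Lvxt Lvt vE.
have YE2 := stable1_reindex Ys mthetaH Lv.
have /(utility_congr_snd Lxt (Ylow _ Lvxt) Lyt Lzt) :
    \forall w \ae P, Y (v xt zt) w = y_ (theta w) w.
  by move: YE1 YE2; apply: filterS2 => w -> ->.
have : \forall w \ae P, u xt (fun w => y_ (theta w) w) zt w =
    u (x_ (theta w)) (y_ (theta w)) (z_ (theta w)) w.
  by have := utility_stable hu cA Lx Ly Lz; rewrite !concat_random_index => /ae_eq_setTP.
by apply: filterS2 => w e1 e2; rewrite /objective e2 e1.
Qed.

(** [utility_usc] asks for a convergent second argument, but Y is only upper semicontinuous. So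
    Y(v(x_k, z_k)) is replaced by its maximum with Y(v(x, z)): this converges to Y(v(x, z)), and by
    monotonicity the replacement only raises u. *)
Lemma objective_usc x_ z_ x z :
  (forall k, L0 G (x_ k)) -> (forall k, L0vec G (z_ k)) -> L0 G x -> L0vec G z ->
  cvg_as P x_ x -> cvgvec_as P z_ z ->
  \forall w \ae P, (limn_esup (fun k => objective (x_ k) (z_ k) w) <= objective x z w)%E.
Proof.
case: hY => Ylow Ys Yi Yusc Lx_ Lz_ Lx Lz xx zz.
have Lv k : L0 H (v (x_ k) (z_ k)) by exact: (wealth_L0 hv).
have Lvx : L0 H (v x z) by exact: (wealth_L0 hv).
pose y_ k w := maxe (Y (v (x_ k) (z_ k)) w) (Y (v x z) w).
have Ly k : L0low P H (y_ k).
  have [m1 f1] := Ylow _ (Lv k); have [m2 f2] := Ylow _ Lvx.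
  split; first exact: measurable_maxe.
  by move: f1 f2; apply: filterS2 => w; rewrite gt_max => -> ->.
have cy : cvge_as P y_ (Y (v x z)).
  have := Yusc _ _ Lv Lvx (wealth_cont hv Lx_ Lz_ Lx Lz xx zz).
  apply: filterS => w usc; apply: limn_esup_le_cvg; last first.
    by move=> n; rewrite le_max lexx orbT.
  apply/limn_esup_leP => c lc.
  have := (limn_esup_leP _ _).2 usc c lc; apply: filterS => n.
  by rewrite ge_max => ->; exact: ltW.
have := utility_usc hu Lx_ Ly Lz_ Lx (Ylow _ Lvx) Lz xx cy zz.
have /ae_foralln : forall k, \forall w \ae P,
    (objective (x_ k) (z_ k) w <= u (x_ k) (y_ k) (z_ k) w)%E.
  move=> k; apply: (utility_incr_snd hu) => //; first exact: Ylow.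
  by apply: aeW => w; rewrite le_max lexx.
apply: filterS2 => w le; apply: le_trans; apply: le_limn_esup.
exact: nearW.
Qed.

Lemma objective_le_fst x x' z : L0 G x -> L0 G x' -> L0vec G z ->
  (\forall w \ae P, x w <= x' w) ->
  \forall w \ae P, (objective x z w <= objective x' z w)%E.
Proof.
case: hY => Ylow Ys Yi Yusc Lx Lx' Lz xx'.
have Lv : L0 H (v x z) by exact: (wealth_L0 hv).
have Lv' : L0 H (v x' z) by exact: (wealth_L0 hv).
have := utility_incr_fst hu Lx Lx' (Ylow _ Lv) Lz xx'.
have := utility_incr_snd hu Lx' (Ylow _ Lv) (Ylow _ Lv') Lz
  (Yi _ _ Lv Lv' (wealth_incr hv Lx Lx' Lz xx')).
by apply: filterS2 => w /[swap]; exact: le_trans.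
Qed.

(** Monotonicity says nothing about z, so upper semicontinuity is used: the constant sequence (a, b)
    converges a.s. to (a', b'). Exchanging the pairs gives the other inequality. *)
Lemma objective_congr x x' z z' : L0 G x -> L0 G x' -> L0vec G z -> L0vec G z' ->
  (\forall w \ae P, x w = x' w) -> (\forall w \ae P, z w = z' w) ->
  \forall w \ae P, objective x z w = objective x' z' w.
Proof.
move=> Lx Lx' Lz Lz' xx' zz'.
have le a a' b b' : L0 G a -> L0 G a' -> L0vec G b -> L0vec G b' ->
    (\forall w \ae P, a w = a' w) -> (\forall w \ae P, b w = b' w) ->
    \forall w \ae P, (objective a b w <= objective a' b' w)%E.
  move=> La La' Lb Lb' aa' bb'.
  have := @objective_usc (fun=> a) (fun=> b) a' b' (fun=> La) (fun=> Lb) La' Lb'.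
  case.
  - by apply: filterS aa' => w <-; exact: cvg_cst.
  - by apply: filterS bb' => w <- i; exact: cvg_cst.
  move=> N [mN PN NE]; exists N; split=> // w /= ab; apply: NE => /= usc.
  by apply: ab; apply: le_trans usc; exact: limn_esup_cst_le.
have := le x x' z z' Lx Lx' Lz Lz' xx' zz'.
have : \forall w \ae P, (objective x' z' w <= objective x z w)%E.
  by apply: le => //; [apply: filterS xx'|apply: filterS zz'].
by apply: filterS2 => w ge' le'; apply/eqP; rewrite eq_le le'.
Qed.

(** As the pairs agree on B, pasting (x, z) on B with (x', z') off B gives (x', z') back; stability
    then evaluates the objective of this pasting on B as that of (x, z). *)
Lemma objective_local B x x' z z' : G B -> L0 G x -> L0 G x' -> L0vec G z -> L0vec G z' ->
  (forall w, B w -> x w = x' w) -> (forall w, B w -> z w = z' w) ->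
  \forall w \ae P, B w -> objective x z w = objective x' z' w.
Proof.
move=> GB Lx Lx' Lz Lz' xx' zz'.
have := @objective_reindex (paste_index B) (fun k => if k is 0%N then x else x')
  (fun k => if k is 0%N then z else z') (random_paste_index sG GB).
have -> : (fun w => (if paste_index B w is 0%N then x else x') w) = x'.
  apply/funext => w; rewrite /paste_index; have [/set_mem/xx'|//] := boolP (w \in B).
  by move=> /= ->.
have -> : (fun w => (if paste_index B w is 0%N then z else z') w) = z'.
  apply/funext => w; rewrite /paste_index; have [/set_mem/zz'|//] := boolP (w \in B).
  by move=> /= ->.
case=> [[]//|[]//|N [mN PN NE]]; exists N; split=> // w /= ab; apply: NE => /= e.
by apply: ab => Bw; rewrite e /paste_index mem_set.
Qed.

End objective.

End one_step_map.

(** * The l1 norm on row vectors *)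

Section l1_norm.
Context {R : realType}.
Implicit Types p : nat.

(** Being a finite sum over coordinates, this norm takes measurability and continuity from the
    coordinates, in terms of which [L0vec] and [cvgvec_as] are stated. *)
Definition l1 p (z : 'rV[R]_p) : R := \sum_i `|z ord0 i|.

Lemma l1_ge0 p (z : 'rV[R]_p) : 0 <= l1 z.
Proof. exact: sumr_ge0. Qed.

Lemma coord_le_l1 p (z : 'rV[R]_p) i : `|z ord0 i| <= l1 z.
Proof. by rewrite /l1 (bigD1 i)//= lerDl sumr_ge0. Qed.

Lemma l1Z p a (z : 'rV[R]_p) : l1 (a *: z) = `|a| * l1 z.
Proof. by rewrite /l1 mulr_sumr; apply: eq_bigr => i _; rewrite mxE normrM. Qed.

Lemma l10 p : l1 (0 : 'rV[R]_p) = 0.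
Proof. by rewrite -(scale0r 0) l1Z normr0 mul0r. Qed.

Lemma cvg_l1 p (z_ : nat -> 'rV[R]_p) (z : 'rV[R]_p) :
  (forall i, z_ n ord0 i @[n --> \oo] --> z ord0 i) -> l1 (z_ n) @[n --> \oo] --> l1 z.
Proof.
move=> zz; apply: cvg_big => [|i _]; last by apply: cvg_norm; exact: zz.
exact: add_continuous.
Qed.

End l1_norm.

(** * Measurability of operations on random vectors *)

Section random_vectors.
Context {R : realType} {dO : measure_display} {Omega : measurableType dO}.
Variables (G : set (set Omega)) (d : nat).
Hypothesis sG : sigma_algebra setT G.
Implicit Types z : Omega -> 'rV[R]_d.

Lemma sub_measurable_l1 z : L0vec G z -> L0 G (fun w => l1 (z w)).
Proof.
move=> Lz; apply: measurable_sum => i; apply: measurableT_comp => //; exact: Lz.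
Qed.

Lemma L0vecZ l z : L0 G l -> L0vec G z -> L0vec G (fun w => l w *: z w).
Proof.
move=> Ll Lz i; rewrite (_ : (fun w => _) = (fun w => l w * z w ord0 i)).
  by apply: measurable_funM => //; exact: Lz.
by apply/funext => w; rewrite mxE.
Qed.

Lemma L0_cst (a : R) : L0 G (fun _ : Omega => a).
Proof. exact: (@measurable_cst _ _ (g_sigma_algebraType G) R setT a). Qed.

Lemma L0vec0 : L0vec G (cst 0 : Omega -> 'rV[R]_d).
Proof.
move=> i; rewrite (_ : (fun w => _) = cst 0); first exact: measurable_cst.
by apply/funext => w; rewrite /= mxE.
Qed.

Lemma sub_measurable_pred (b : Omega -> bool) : sub_measurable G b -> G [set w | b w].
Proof.
move=> mb; apply/(sub_sigmaP sG); have := mb measurableT [set true] I.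
by rewrite setTI.
Qed.

End random_vectors.

(** * Boundedness of superlevel sets of the myopic objective *)

Section bounded.
Context {R : realType} {dO : measure_display} {Omega : measurableType dO}.
Variables (P : probability Omega R) (d : nat) (G H : set (set Omega)).
Hypotheses (sG : sigma_algebra setT G) (sH : sigma_algebra setT H).
Hypotheses (GH : G `<=` H) (HM : H `<=` measurable).
Variables (v : (Omega -> R) -> (Omega -> 'rV[R]_d) -> Omega -> R)
  (u : (Omega -> R) -> (Omega -> \bar R) -> (Omega -> 'rV[R]_d) -> Omega -> \bar R).
Hypotheses (hv : wealth_map P G H v) (hu : utility_map P G H u).

(* The objective for the continuation value Y(x) = x, which is the one that [hK]
   bounds. *)
Definition myopic := objective v u (fun x => EFin \o x).

(** By (v6), (u5) and (u7): u(x, v(x, 0), 0) = u(x, 0 + x, 0) = u(x, 0, 0) + x = x. *)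
Lemma myopic0 x : L0 G x -> \forall w \ae P, myopic x (cst 0) w = (x w)%:E.
Proof.
move=> Lx; have Lx' : L0 H x by exact: sub_measurableS Lx.
have L00 : L0vec G (cst 0 : Omega -> 'rV[R]_d) by exact: L0vec0.
have L0e : L0low P H (cst 0%E) by apply: (@L0low_EFin _ _ _ P H (cst 0)); exact: L0_cst.
have /ae_eq_setTP vx := wealth_zero hv Lx.
have /(utility_congr_snd hu Lx _ _ L00) : \forall w \ae P, (EFin \o v x (cst 0)) w = (EFin \o x) w.
  by apply: filterS vx => w /= ->.
move=> /(_ (L0low_EFin P (wealth_L0 hv Lx L00)) (L0low_EFin P Lx')) e1.
have /ae_eq_setTP := utility_translation hu Lx L0e L00 Lx.
have -> : (fun w => cst 0%E w + (x w)%:E)%E = EFin \o x.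
  by apply/funext => w /=; rewrite add0e.
have /ae_eq_setTP := utility_zero hu Lx.
move: e1; apply: filterS3 => w; rewrite /myopic /objective => -> -> ->.
by rewrite /= add0e.
Qed.

(** The vector l z combines z and 0 with weights l and 1 - l. Quasi-concavity bounds u from below at
    the combination of (v(x, z), z) and (v(x, 0), 0), the latter contributing x by [myopic0];
    concavity puts v(x, l z) above the combined wealth. *)
Lemma myopic_shrink x z l : L0 G x -> L0vec G z -> L0 G l -> (forall w, 0 <= l w <= 1) ->
  \forall w \ae P, (mine (myopic x z w) (x w)%:E <= myopic x (fun w => l w *: z w) w)%E.
Proof.
move=> Lx Lz Ll l01.
have L00 : L0vec G (cst 0 : Omega -> 'rV[R]_d) by exact: L0vec0.
have Llz : L0vec G (fun w => l w *: z w) by exact: L0vecZ.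
have Lv z' : L0vec G z' -> L0 H (v x z') by exact: (wealth_L0 hv).
have aeW01 : \forall w \ae P, 0 <= l w <= 1 by exact: aeW.
have lz0 : (fun w => l w *: z w + (1 - l w) *: (cst 0 : Omega -> 'rV[R]_d) w) =
    (fun w => l w *: z w) by apply/funext => w; rewrite scaler0 addr0.
have := wealth_concave hv Lx Lz L00 Ll aeW01; rewrite lz0 => conc.
pose y w := l w * v x z w + (1 - l w) * v x (cst 0) w.
have LlH : L0 H l by exact: sub_measurableS Ll.
have Ly : L0 H y.
  apply: measurable_funD; apply: measurable_funM => //; try exact: Lv.
  exact: measurable_funB.
have yv : \forall w \ae P, ((EFin \o y) w <= (EFin \o v x (fun w' => l w' *: z w')) w)%E.
  by apply: filterS conc => w; rewrite /= lee_fin.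
have incr := utility_incr_snd hu Lx (L0low_EFin P Ly) (L0low_EFin P (Lv _ Llz)) Llz yv.
have := utility_quasiconcave hu Lx (L0low_EFin P (Lv _ Lz)) (L0low_EFin P (Lv _ L00))
  Lz L00 Ll aeW01.
rewrite lz0 => qc; have := myopic0 Lx; move: qc incr.
by apply: filterS3 => w qc incr <-; apply: le_trans incr.
Qed.

(** Here z is (n+1) z with weight 1/(n+1) plus 0 with the remaining weight. Concavity and (v6) give
    v(x, (n+1) z) <= (n+1) (v(x, z) - x) + x, and (u5) takes the last x out of u. *)
Lemma myopic_scale_bound x z n : L0 G x -> L0vec G z ->
  \forall w \ae P, (myopic x (fun w => n.+1%:R *: z w) w <=
    u x (fun w => n.+1%:R%:E * (v x z w - x w)%:E) (fun w => (n.+1%:R *: z w)%R) w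
    + (x w)%:E)%E.
Proof.
move=> Lx Lz; have Ln : L0 G (cst (n.+1%:R : R)) by exact: L0_cst.
have LnV : L0 G (cst (n.+1%:R^-1 : R)) by exact: L0_cst.
have Lnz : L0vec G (fun w => n.+1%:R *: z w) by exact: (L0vecZ Ln).
have L00 : L0vec G (cst 0 : Omega -> 'rV[R]_d) by exact: L0vec0.
have Lv z' : L0vec G z' -> L0 H (v x z') by exact: (wealth_L0 hv).
have LxH : L0 H x by exact: sub_measurableS Lx.
have n1 : \forall w \ae P, 0 <= (cst n.+1%:R^-1 : Omega -> R) w <= 1.
  by apply: aeW => w; rewrite /= invr_ge0 ler0n invf_le1// ler1n.
have := wealth_concave hv Lx Lnz L00 LnV n1.
have -> : (fun w' => cst n.+1%:R^-1 w' *: (n.+1%:R *: z w') +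
    (1 - cst n.+1%:R^-1 w') *: (cst 0 : Omega -> 'rV[R]_d) w') = z.
  by apply/funext => w; rewrite scaler0 addr0 /= scalerA mulVf ?scale1r.
have /ae_eq_setTP vx := wealth_zero hv Lx; move=> conc.
pose y w : R := n.+1%:R * (v x z w - x w).
have Ly : L0 H y.
  by apply: measurable_funM => //; apply: measurable_funB => //; exact: Lv.
have Lyx : L0 H (fun w => y w + x w) by exact: measurable_funD.
have yv : \forall w \ae P,
    ((EFin \o v x (fun w => n.+1%:R *: z w)%R) w <= (EFin \o (fun w => y w + x w)%R) w)%E.
  move: conc vx; apply: filterS2 => w /= + vxw; rewrite vxw lee_fin => conc.
  have := ler_wpM2l (ler0n R n.+1) conc; rewrite mulrDr !mulrA mulfV// mul1r.
  rewrite mulrBr mulr1 mulfV// /y mulrBr => h.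
  by rewrite -lerBlDr; apply: le_trans (lerB h (lexx _)) => //; lra.
have := utility_incr_snd hu Lx (L0low_EFin P (Lv _ Lnz)) (L0low_EFin P Lyx) Lnz yv.
have /ae_eq_setTP := utility_translation hu Lx (L0low_EFin P Ly) Lnz Lx.
by apply: filterS2 => w <-.
Qed.

(** The event A of unboundedness is shown to be null. Normalizing on A and passing to a limit gives
    W with norm 1 on A and 0 elsewhere; coercivity along multiples of W contradicts the lower bound
    min(c, x) at almost every point of A. *)
Lemma myopic_bounded x (c : Omega -> R) (Z : nat -> Omega -> 'rV[R]_d) :
  L0 G x -> (forall n, L0vec G (Z n)) ->
  (forall n, \forall w \ae P, ((c w)%:E <= myopic x (Z n) w)%E) ->
  \forall w \ae P, exists M, forall n, l1 (Z n w) <= M.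
Proof.
move=> Lx LZ cZ.
pose A := [set w | forall m, exists2 n, (m <= n)%N & m.+1%:R < l1 (Z n w)].
have GE m n : G [set w | m.+1%:R < l1 (Z n w)].
  apply: sub_measurable_pred => //; apply: measurable_fun_ltr => //.
  exact: sub_measurable_l1.
have GA : G A.
  rewrite (_ : A = \bigcap_m \bigcup_(n in [set n | (m <= n)%N]) [set w | m.+1%:R < l1 (Z n w)]).
    apply/(sub_sigmaP sG)/bigcap_measurableType => m _.
    by apply: bigcup_measurable => n _; exact/(sub_sigmaP sG).
  apply/seteqP; split=> [w Aw m _|w Aw m]; first by have [n mn nw] := Aw m; exists n.
  by have [n mn nw] := Aw m I; exists n.
have nA w : ~ A w -> exists M, forall n, l1 (Z n w) <= M.
  (* From index m on the norms are at most m+1; the finitely many earlier ones are absorbed by their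
     sum. *)
  move=> /existsNP[m /forall2NP h]; exists (m.+1%:R + \sum_(i < m) l1 (Z i w)) => n.
  have s0 : 0 <= \sum_(i < m) l1 (Z i w) by apply: sumr_ge0 => i _; exact: l1_ge0.
  have [mn|nm] := leqP m n.
    by have [/negP//|/negP] := h n; rewrite -leNgt => h'; rewrite (le_trans h')// lerDl.
  rewrite (bigD1 (Ordinal nm))//= addrCA lerDl addr_ge0//.
  by apply: sumr_ge0 => i _; exact: l1_ge0.
suff : \forall w \ae P, ~ A w by apply: filterS.
(* Adding the complement of A makes the selection possible at every w; the norm condition is imposed
   on A only. *)
pose E m k := ~` A `|` [set w | m.+1%:R < l1 (Z k w)].
have mE m k : measurable (E m k : set (g_sigma_algebraType G)).
  apply: measurableU; last exact/(sub_sigmaP sG).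
  by apply: measurableC; exact/(sub_sigmaP sG).
have [m w|tau [mtau _ tauE]] := measurable_first mE.
  have [Aw|nAw] := pselect (A w); last by exists m => //; left.
  by have [n mn ?] := Aw m; exists n => //; right.
have Gtau m : random_index G (tau m) by apply: (random_index_sub sG _).2; exact: mtau.
pose Zt m (w : Omega) := Z (tau m w) w.
have LZt m : L0vec G (Zt m) by exact: L0vec_reindex.
have AZt m w : A w -> m.+1%:R < l1 (Zt m w) by move=> Aw; have [] := tauE m w.
(* The inverse norm on A, written as a power for the sake of measurability; the value 0 elsewhere
   makes W vanish off A. *)
pose lam m w := if w \in A then l1 (Zt m w) `^ (-1) else 0.
have Llam m : L0 G (lam m).
  apply: sub_measurable_paste => //; last exact: L0_cst.
  exact: (measurableT_comp (@measurable_powR R (-1)) (sub_measurable_l1 (LZt m))).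
have lamE m w : A w -> lam m w = (l1 (Zt m w))^-1.
  by move=> Aw; rewrite /lam mem_set// powR_inv1// l1_ge0.
have lamN m w : ~ A w -> lam m w = 0 by move=> nAw; rewrite /lam memNset.
pose W_ m w := lam m w *: Zt m w.
have l1W m w : l1 (W_ m w) = (w \in A)%:R.
  rewrite /W_ l1Z; have [Aw|nAw] := pselect (A w).
    have l1Z0 : 0 < l1 (Zt m w) by apply: le_lt_trans (AZt m w Aw).
    by rewrite lamE// mem_set// gtr0_norm ?invr_gt0// mulVf// gt_eqF.
  by rewrite lamN// normr0 mul0r memNset.
have LW m : L0vec G (W_ m) by exact: L0vecZ.
have [|theta [W [mtheta ntheta LW' WW]]] :=
    @random_bolzano_weierstrass R _ (g_sigma_algebraType G) d W_ LW.
  move=> w i; exists 1 => n; apply: le_trans (coord_le_l1 _ _) _.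
  by rewrite l1W lern1 leq_b1.
have Gtheta n : random_index G (theta n) by apply: (random_index_sub sG _).2; exact: mtheta.
have l1W' w : l1 (W w) = (w \in A)%:R.
  have : l1 (W_ (theta n w) w) @[n --> \oo] --> l1 (W w) by apply: cvg_l1; exact: WW.
  have -> : (fun n => l1 (W_ (theta n w) w)) = cst (w \in A)%:R.
    by apply/funext => n; exact: l1W.
  by move=> /(@cvg_unique _ (@Rhausdorff R)) h; apply: h; exact: cvg_cst.
have lW n : \forall w \ae P,
    (mine (c w)%:E (x w)%:E <= myopic x (fun w => n%:R *: W w) w)%E.
  (* n times the normalized vector is [Zt m] shrunk by n [lam m], a factor in [0, 1] once n <= m
     because the norm exceeds m+1 on A. The value 0 for m < n keeps the factor in [0, 1] and does
     not affect the limit. *)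
  pose mu m : Omega -> R := if (n <= m)%N then fun w => n%:R * lam m w else fun=> 0.
  have Lmu m : L0 G (mu m).
    rewrite /mu; case: ifP => _; last exact: L0_cst.
    exact: (measurable_funM (@L0_cst R _ _ G n%:R) (Llam m)).
  have mu01 m w : 0 <= mu m w <= 1.
    rewrite /mu; case: ifPn => [nm|_]; last by rewrite lexx ler01.
    have [Aw|nAw] := pselect (A w); last by rewrite lamN// mulr0 lexx ler01.
    have l1Z0 : 0 < l1 (Zt m w) by apply: le_lt_trans (AZt m w Aw).
    rewrite lamE// divr_ge0//=; last exact: ltW.
    rewrite ler_pdivrMr// mul1r (le_trans _ (ltW (AZt m w Aw)))// ler_nat.
    exact: leqW.
  pose V m w := mu m w *: Zt m w.
  have LV m : L0vec G (V m) by exact: L0vecZ.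
  have cV : \forall w \ae P, forall m, (mine (c w)%:E (x w)%:E <= myopic x (V m) w)%E.
    apply: ae_foralln => m.
    have e := objective_reindex sG sH GH hv hu (admissible_EFin P H) (Gtau m)
      (fun=> Lx) LZ.
    have sh := myopic_shrink Lx (LZt m) (Lmu m) (mu01 m).
    have /ae_foralln cZ' := cZ.
    move: e sh cZ'; apply: filterS3 => w e sh cZ'.
    apply: le_trans sh; rewrite le_min2// [leRHS]e.
    exact: cZ'.
  have cVt : \forall w \ae P, forall m,
      (mine (c w)%:E (x w)%:E <= myopic x (fun w => V (theta m w) w) w)%E.
    apply: ae_foralln => m.
    have e := objective_reindex sG sH GH hv hu (admissible_EFin P H) (Gtheta m)
      (fun=> Lx) LV.
    move: e cV; apply: filterS2 => w e cV.
    by rewrite [leRHS]e; exact: cV.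
  have LVt m : L0vec G (fun w => V (theta m w) w) by exact: L0vec_reindex.
  have LnW : L0vec G (fun w => n%:R *: W w).
    by apply: (@L0vecZ _ _ _ _ _ (cst n%:R)) => //; exact: L0_cst.
  have cvgV : cvgvec_as P (fun m w => V (theta m w) w) (fun w => n%:R *: W w).
    apply: aeW => w i; rewrite mxE.
    have : n%:R * W_ (theta k w) w ord0 i @[k --> \oo] --> n%:R * W w ord0 i.
      by apply: cvgMr; exact: WW.
    apply: cvg_trans; apply: near_eq_cvg; exists n => // k /= nk.
    by rewrite /W_ /V /mu (leq_trans nk)// !mxE mulrA.
  have cvgx : cvg_as P (fun=> x) x by apply: aeW => w; exact: cvg_cst.
  have := objective_usc hv hu (admissible_EFin P H) (fun=> Lx) LVt Lx LnW cvgx cvgV.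
  move: cVt; apply: filterS2 => w cVt; apply: le_trans.
  exact: limn_esup_cst_le.
have Lv : L0 H (v x W) by exact: (wealth_L0 hv).
have LxH : L0 H x by exact: sub_measurableS Lx.
have Ly : L0 H (fun w => v x W w - x w) by exact: measurable_funB.
have [p pP] : exists p, is_cond_prob P G [set w | v x W w < x w] p.
  apply: exists_cond_prob => //; first exact: subset_trans HM.
  apply: HM; apply: sub_measurable_pred => //.
  by apply: measurable_fun_ltr.
have p0 := wealth_loss hv Lx LW' pP.
have Lyl := L0low_EFin P Ly.
have := utility_coercive hu Lx Lyl LW' (p := p).
rewrite (_ : [set w | _] = [set w | v x W w < x w]); last first.
  by apply/seteqP; split=> w /=; rewrite lte_fin subr_lt0.
move=> /(_ pP) coer.
have ub : \forall w \ae P, forall n, (mine (c w)%:E (x w)%:E <=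
    u x (fun w => n.+1%:R%:E * (v x W w - x w)%:E) (fun w => (n.+1%:R *: W w)%R) w
    + (x w)%:E)%E.
  apply: ae_foralln => n; have := myopic_scale_bound n Lx LW'; have := lW n.+1.
  by apply: filterS2 => w; exact: le_trans.
move: p0 coer ub; apply: filterS3 => w p0 coer ub Aw.
have W0 : W w != 0.
  by apply/eqP => W0; have := l1W' w; rewrite W0 l10 mem_set// => /esym/eqP; rewrite oner_eq0.
have /cvgeNyPlt := coer (p0 W0).
(* From N on, coercivity pushes the utility below min(c, x) - x. At the multiple N+1 this
   contradicts [ub N]. *)
move=> /(_ (Num.min (c w) (x w) - x w)) [N _ /(_ N.+1 (leqnSn N))] /=.
rewrite ltNge => /negP; apply; have := ub N.
rewrite -EFin_min -leeBlDr//.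
Qed.

End bounded.

(** * Limit superior of objectives along varying wealths and vectors *)

Section key.
Context {R : realType} {dO : measure_display} {Omega : measurableType dO}.
Variables (P : probability Omega R) (d : nat) (G H : set (set Omega)).
Hypotheses (sG : sigma_algebra setT G) (sH : sigma_algebra setT H).
Hypotheses (GH : G `<=` H) (HM : H `<=` measurable).
Variables (v : (Omega -> R) -> (Omega -> 'rV[R]_d) -> Omega -> R)
  (u : (Omega -> R) -> (Omega -> \bar R) -> (Omega -> 'rV[R]_d) -> Omega -> \bar R).
Hypotheses (hv : wealth_map P G H v) (hu : utility_map P G H u).
Variable Y : (Omega -> R) -> Omega -> \bar R.
Hypothesis hY : admissible P H Y.
Variables C K : R.
Hypothesis Yle : forall x, L0 H x -> \forall w \ae P, (Y x w <= (x w + C)%:E)%E.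
Hypothesis myopic_le : forall x z, L0 G x -> L0vec G z ->
  \forall w \ae P, (myopic v u x z w <= (x w + K)%:E)%E.
Local Notation obj := (objective v u Y).

Lemma objective_le_myopic x z : L0 G x -> L0vec G z ->
  \forall w \ae P, (obj x z w <= myopic v u x z w + C%:E)%E.
Proof.
move=> Lx Lz; have Lv : L0 H (v x z) by exact: (wealth_L0 hv).
have [Ylow _ _ _] := hY.
have LC : L0 H (fun w => v x z w + C) by apply: measurable_funD => //; exact: L0_cst.
have := utility_incr_snd hu Lx (Ylow _ Lv) (L0low_EFin P LC) Lz (Yle Lv).
have /ae_eq_setTP := utility_translation hu Lx (L0low_EFin P Lv) Lz (@L0_cst R _ _ G C).
by apply: filterS2 => w <-.
Qed.

Lemma objective_le x z : L0 G x -> L0vec G z ->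
  \forall w \ae P, (obj x z w <= (x w + (K + C))%:E)%E.
Proof.
move=> Lx Lz; move: (objective_le_myopic Lx Lz) (myopic_le Lx Lz).
apply: filterS2 => w le1 le2; apply: (le_trans le1); rewrite addrA EFinD.
exact: leeD2r.
Qed.

Lemma le_of_sub_inv (s l : \bar R) :
  (forall n, s - n.+1%:R^-1%:E <= l)%E -> (s <= l)%E.
Proof.
move=> sl; apply/lee_addgt0Pr => e e0.
have [n ne] : exists n, n.+1%:R^-1 < e.
  by exists (Num.truncn e^-1); rewrite invf_plt ?posrE// truncnS_gt.
rewrite -leeBlDr//; apply: le_trans (sl n); apply: leeB => //.
by rewrite lee_fin ltW.
Qed.

(** The pointwise supremum, finite wherever the sequence converges; [fine] supplies a real value on
    the exceptional null set. *)
Lemma L0_cvg_bound (x_ : nat -> Omega -> R) x : (forall k, L0 G (x_ k)) -> cvg_as P x_ x ->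
  exists2 b, L0 G b & \forall w \ae P, forall k, x_ k w <= b w.
Proof.
move=> Lx xx; pose S w := esups (fun k => (x_ k w)%:E) 0%N.
have mS : sub_measurable G S.
  by apply: measurable_fun_esups => k; apply/measurable_EFinP; exact: Lx.
have mfS : sub_measurable G (fine \o S) by exact: measurableT_comp.
exists (fine \o S) => //.
apply: filterS xx => w /cvgP/cvg_seq_bounded[M [_ /(_ (M + 1))]].
rewrite ltrDl => /(_ ltr01) xM k.
have le k' : ((x_ k' w)%:E <= S w)%E by apply: ereal_sup_ubound; exists k'.
rewrite -lee_fin/= fineK//; apply/fin_real/andP; split.
  by apply: lt_le_trans (le 0%N); exact: ltNyr.
apply: (@le_lt_trans _ _ (M + 1)%:E); last exact: ltry.
apply: ge_ereal_sup => _ [n _ <-]; rewrite lee_fin.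
by apply: le_trans (ler_norm _) _; exact: xM.
Qed.

Lemma objective_limsup_attained x_ x z_ :
  (forall k, L0 G (x_ k)) -> L0 G x -> cvg_as P x_ x -> (forall k, L0vec G (z_ k)) ->
  exists2 z, L0vec G z &
    \forall w \ae P, (limn_esup (fun k => obj (x_ k) (z_ k) w) <= obj x z w)%E.
Proof.
move=> Lx_ Lx xx Lz_; pose S w := limn_esup (fun k => obj (x_ k) (z_ k) w).
have ma k : sub_measurable G (obj (x_ k) (z_ k)) by exact: (objective_low hv hu hY _ _).1.
have mS : sub_measurable G S by exact: measurable_fun_limn_esup.
(* Where S is finite it can be approached within 1/(n+1). Off B, the value +oo is excluded a.s. by
   the upper bound on the objective, and for -oo the claim is trivial. *)
pose B := [set w | S w \is a fin_num].
have GB : G B.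
  by apply/(sub_sigmaP sG); rewrite -[X in measurable X]setTI; exact: emeasurable_fin_num.
have GBC : G (~` B) by apply/(sub_sigmaP sG)/measurableC/(sub_sigmaP sG).
pose E n k := ~` B `|` [set w | (S w - n.+1%:R^-1%:E < obj (x_ k) (z_ k) w)%E].
have mE n k : measurable (E n k : set (g_sigma_algebraType G)).
  apply: measurableU; first exact/(sub_sigmaP sG).
  apply/(sub_sigmaP sG); apply: (sub_measurable_pred sG).
  apply: measurable_fun_lte => //.
  apply: (@emeasurable_funB _ (g_sigma_algebraType G) R setT S (cst n.+1%:R^-1%:E)) => //.
  exact: ma.
have [n w|sigma [msigma nsigma sigmaE]] := measurable_first mE.
  have [Bw|nBw] := pselect (B w); last by exists n => //; left.
  have : (S w - n.+1%:R^-1%:E < S w)%E.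
    by rewrite lteBlDr// lteDl// lte_fin invr_gt0.
  by move/limn_esup_gt_frequently => /(_ n)[k nk kS]; exists k => //; right.
have Gsigma n : random_index G (sigma n) by apply: (random_index_sub sG _).2; exact: msigma.
pose x1 n w := x_ (sigma n w) w.
pose zs n w := z_ (sigma n w) w.
(* Zero vectors off B: there the selected indices carry no lower bound on the objective that would
   control the norms. *)
pose z1 n (w : Omega) := if w \in B then zs n w else 0.
have Lx1 n : L0 G (x1 n) by exact: L0_reindex.
have Lzs n : L0vec G (zs n) by exact: L0vec_reindex.
have L00 : L0vec G (cst 0 : Omega -> 'rV[R]_d) by exact: L0vec0.
have Lz1 n : L0vec G (z1 n) by exact: (L0vec_paste sG GB (Lzs n) L00).
have obj1 : \forall w \ae P, forall n, B w ->
    (S w - n.+1%:R^-1%:E < obj (x1 n) (z1 n) w)%E.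
  apply: ae_foralln => n.
  have z1B w : B w -> z1 n w = zs n w by move=> Bw; rewrite /z1 mem_set.
  have := objective_local sG sH GH hv hu hY GB (Lx1 n) (Lx1 n) (Lz1 n) (Lzs n)
    (fun _ _ => erefl) z1B.
  have := objective_reindex sG sH GH hv hu hY (Gsigma n) Lx_ Lz_.
  apply: filterS2 => w e1 e2 Bw; rewrite e2// [ltRHS]e1.
  by have [] := sigmaE n w.
(* [myopic_bounded] works with a fixed wealth; monotonicity transfers the lower bounds to the common
   bound b of all x_k. *)
have [b Lb xb] := L0_cvg_bound Lx_ xx.
(* On B the objective exceeds S - 1/(n+1) >= S - 1 and is at most the myopic one plus C; off B the
   vector is 0 and the myopic objective is b. *)
pose c w := if w \in B then fine (S w) - 1 - C else b w.
have cz1 n : \forall w \ae P, ((c w)%:E <= myopic v u b (z1 n) w)%E.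
  have z10 w : (~` B) w -> z1 n w = cst 0 w by move=> nBw; rewrite /z1 memNset.
  have off := objective_local sG sH GH hv hu (admissible_EFin P H) GBC Lb Lb (Lz1 n) L00
    (fun _ _ => erefl) z10.
  have offE := myopic0 sG sH GH hv hu Lb.
  have le1 : \forall w \ae P, (obj (x1 n) (z1 n) w <= obj b (z1 n) w)%E.
    apply: (objective_le_fst hv hu hY) => //.
    by apply: filterS xb => w; exact.
  have le2 := objective_le_myopic Lb (Lz1 n).
  have {le1 le2} : \forall w \ae P, (obj (x1 n) (z1 n) w <= myopic v u b (z1 n) w + C%:E)%E.
    by move: le1 le2; apply: filterS2 => w; exact: le_trans.
  have {off offE} : \forall w \ae P, ~ B w -> myopic v u b (z1 n) w = (b w)%:E.
    by move: off offE; apply: filterS2 => w off <- nB; rewrite [LHS]off.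
  move: obj1; apply: filterS3 => w ob off le; rewrite /c.
  have [/set_mem Bw|/negP nBw] := boolP (w \in B); last first.
    by rewrite off// => Bw; apply: nBw; exact/mem_set.
  have := lt_le_trans (ob n Bw) le; move/ltW; rewrite -leeBlDr//; apply: le_trans.
  rewrite -(fineK (Bw : S w \is a fin_num)) -!EFinB lee_fin/=.
  by rewrite !lerB// invf_le1// ler1n.
have bnd := myopic_bounded sG sH GH HM hv hu Lb Lz1 cz1.
(* Integer bounds make D a countable combination of events in G. As D has full measure, zeroing the
   vectors off D changes them on a null set only and makes them bounded at every w, as
   [random_bolzano_weierstrass] requires. *)
pose D := [set w | exists m, forall n, l1 (z1 n w) <= m%:R].
have GD : G D.
  have -> : D = \bigcup_m \bigcap_n [set w | l1 (z1 n w) <= m%:R].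
    apply/seteqP; split=> [w [m wm]|w [m _ wm]]; first by exists m => // n _; exact: wm.
    by exists m => n; exact: wm.
  apply/(sub_sigmaP sG); apply: bigcup_measurable => m _.
  apply: bigcap_measurableType => n _; apply/(sub_sigmaP sG).
  apply: (sub_measurable_pred sG); apply: measurable_fun_ler; first exact: sub_measurable_l1.
  exact: L0_cst.
have aeD : \forall w \ae P, D w.
  apply: filterS bnd => w [M zM]; exists (Num.truncn M).+1 => n.
  by apply: le_trans (zM n) _; apply/ltW; exact: truncnS_gt.
pose Z n (w : Omega) := if w \in D then z1 n w else 0.
have LZ n : L0vec G (Z n) by exact: (L0vec_paste sG GD (Lz1 n) L00).
have [|theta [z [mtheta ntheta Lz Zz]]] :=
    @random_bolzano_weierstrass R _ (g_sigma_algebraType G) d Z LZ.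
  move=> w i; rewrite /Z; have [/set_mem[m zm]|_] := boolP (w \in D).
    by exists m%:R => n; apply: le_trans (coord_le_l1 _ _) _.
  by exists 0 => n; rewrite mxE normr0.
have Gtheta n : random_index G (theta n) by apply: (random_index_sub sG _).2; exact: mtheta.
exists z; first exact: Lz.
pose xf n (w : Omega) := x1 (theta n w) w; pose zf n (w : Omega) := Z (theta n w) w.
have Lxf n : L0 G (xf n) by exact: L0_reindex.
have Lzf n : L0vec G (zf n) by exact: L0vec_reindex.
have cxf : cvg_as P xf x.
  apply: filterS xx => w xxw.
  apply: (@cvg_reindex_ge _ (fun k => x_ k w) (x w) (fun n => sigma (theta n w) w)) => // n.
  exact: leq_trans (nsigma _ _).
have czf : cvgvec_as P zf z by apply: aeW => w i; exact: Zz.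
have usc := objective_usc hv hu hY Lxf Lzf Lx Lz cxf czf.
have objf : \forall w \ae P, forall n, B w -> (S w - n.+1%:R^-1%:E < obj (xf n) (zf n) w)%E.
  have Zz1 : \forall w \ae P, forall k, obj (x1 k) (Z k) w = obj (x1 k) (z1 k) w.
    apply: ae_foralln => k; apply: (objective_congr hv hu hY) => //; first exact: aeW.
    by apply: filterS aeD => w Dw; rewrite /Z mem_set.
  apply: ae_foralln => n.
  have := objective_reindex sG sH GH hv hu hY (Gtheta n) Lx1 LZ.
  move: obj1 Zz1; apply: filterS3 => w obj1 Zz1 e Bw; rewrite [ltRHS]e Zz1.
  (* Since [theta n w] >= n, the error at that index is at most 1/(n+1). *)
  apply: le_lt_trans (obj1 _ Bw); apply: leeB => //.
  by rewrite lee_fin lef_pV2 ?posrE// ler_nat ltnS.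
have ub : \forall w \ae P, forall k, (obj (x_ k) (z_ k) w <= (b w + (K + C))%:E)%E.
  apply: ae_foralln => k; have := objective_le (Lx_ k) (Lz_ k).
  by move: xb; apply: filterS2 => w xb le; apply: le_trans le _; rewrite lee_fin lerD2r.
move: usc objf ub; apply: filterS3 => w usc objf ub; rewrite -/(S w).
have Sy : (S w < +oo)%E.
  apply: (@le_lt_trans _ _ (b w + (K + C))%:E); last exact: ltry.
  by apply/limn_esup_leP => e be; apply: nearW => k; exact: le_trans (ub k) (ltW be).
have [->|SNy] := eqVneq (S w) -oo%E; first exact: leNye.
have Bw : B w by rewrite /B/= fin_numE SNy lt_eqF.
apply: le_of_sub_inv => n; apply: le_trans usc.
apply: (@le_trans _ _ (limn_esup (fun=> S w - n.+1%:R^-1%:E)%E)).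
  exact: limn_esup_cst_le.
apply: le_limn_esup; exists n => // k /= nk.
have kn : (S w - n.+1%:R^-1%:E <= S w - k.+1%:R^-1%:E)%E.
  by apply: leeB => //; rewrite lee_fin lef_pV2 ?posrE// ler_nat ltnS.
exact: le_trans kn (ltW (objf k Bw)).
Qed.

End key.

(** * Measurability and semicontinuity under [contract] *)

Section contract_measurable.
Context {R : realType} d (T : measurableType d).

(** For -1 <= r < 1 the preimage of ]r, +oo[ is that of ][expand r], +oo] under f; for other r it is
    empty or everything. *)
Lemma measurable_contract (f : T -> \bar R) : measurable_fun setT f ->
  measurable_fun setT (@contract R \o f).
Proof.
move=> mf; apply: (measurability _ (RGenOInfty.measurableE R)) => _ [_ [r ->] <-].
rewrite setTI.
have [r1|r1] := lerP 1 r.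
  rewrite (_ : _ @^-1` _ = set0)//; apply/seteqP; split=> w //=.
  rewrite in_itv/= andbT ltNge => /negP; apply; apply: le_trans r1.
  by have := contract_le1 (f w); rewrite ler_norml => /andP[].
have [r2|r2] := ltrP r (-1).
  rewrite (_ : _ @^-1` _ = setT)//; apply/seteqP; split=> w //= _.
  rewrite in_itv/= andbT (lt_le_trans r2)//.
  by have := contract_le1 (f w); rewrite ler_norml => /andP[].
rewrite (_ : _ @^-1` _ = f @^-1` `]expand r, +oo[).
  by rewrite -[X in measurable X]setTI; apply: mf => //; exact: emeasurable_itv.
have rE w : (expand r < f w)%E = (r < contract (f w)).
  by rewrite -lt_contract expandK// inE ler_norml r2 ltW.
by apply/seteqP; split=> w /=; rewrite !in_itv/= !andbT rE.
Qed.

(** A decreasing bounded transform turns an upper bound on the limsup into a lower bound on a liminf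
    of nonnegative terms, the form that Fatou's lemma takes. *)
Lemma contract_limn_esup (a : nat -> \bar R) l : (limn_esup a <= l)%E ->
  ((1 - contract l)%:E <= limn_einf (fun n => (1 - contract (a n))%:E))%E.
Proof.
move=> al; rewrite /limn_einf leeNr -EFinN opprB; apply/limn_esup_leP => -[c| |] //=.
- rewrite lte_fin => lc.
  (* The terms are [contract (a n)] - 1 <= 0, so only c < 0 matters; then c + 1 lies in [-1, 1] and
     can be expanded. *)
  have [c0|c0] := lerP 0 c.
    apply: nearW => n; rewrite lee_fin opprB (le_trans _ c0)// subr_le0.
    by have := contract_le1 (a n); rewrite ler_norml => /andP[].
  have c1 : c + 1 \in [pred r | `|r| <= 1].
    rewrite inE ler_norml; have := contract_le1 l; rewrite ler_norml => /andP[l1 _].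
    by apply/andP; split; lra.
  have := (limn_esup_leP _ _).2 al (expand (c + 1)).
  rewrite -lt_contract expandK//; case; first by lra.
  move=> N _ Na; exists N => // n /Na /=; rewrite -le_contract expandK// => an.
  by rewrite lee_fin; lra.
- by move=> _; apply: nearW => n; rewrite leey.
Qed.

End contract_measurable.

(** * Attained essential suprema *)

Section essential_supremum.
Context {R : realType} {dO : measure_display} {Omega : measurableType dO}.
Variables (P : probability Omega R) (G : set (set Omega)).
Hypotheses (sG : sigma_algebra setT G) (GM : G `<=` measurable).

Lemma esssup_max V (D : set V) (f : V -> Omega -> \bar R) z : D z ->
  (forall z, D z -> sub_measurable G (f z)) ->
  (forall z', D z' -> \forall w \ae P, (f z' w <= f z w)%E) ->
  \forall w \ae P, esssup P G (f @` D) w = f z w.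
Proof.
move=> Dz mf fz.
have [|_ ub least] := @is_esssup_esssup _ _ _ P G (f @` D) sG GM.
  by move=> _ [z' Dz' <-]; exact: mf.
have : \forall w \ae P, (esssup P G (f @` D) w <= f z w)%E.
  apply: least; first exact: (sub_measurableW sG GM (mf z Dz)).
  by move=> _ [z' Dz' <-]; exact: fz.
have : \forall w \ae P, (f z w <= esssup P G (f @` D) w)%E by apply: ub; exists z.
by apply: filterS2 => w le1 le2; apply/eqP; rewrite eq_le le1 le2.
Qed.

End essential_supremum.

(** * Existence of a maximizer *)

Section maximum.
Context {R : realType} {dO : measure_display} {Omega : measurableType dO}.
Variables (P : probability Omega R) (d : nat) (G H : set (set Omega)).
Hypotheses (sG : sigma_algebra setT G) (sH : sigma_algebra setT H).
Hypotheses (GH : G `<=` H) (HM : H `<=` measurable).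
Variables (v : (Omega -> R) -> (Omega -> 'rV[R]_d) -> Omega -> R)
  (u : (Omega -> R) -> (Omega -> \bar R) -> (Omega -> 'rV[R]_d) -> Omega -> \bar R).
Hypotheses (hv : wealth_map P G H v) (hu : utility_map P G H u).
Variable Y : (Omega -> R) -> Omega -> \bar R.
Hypothesis hY : admissible P H Y.
Variables C K : R.
Hypothesis Yle : forall x, L0 H x -> \forall w \ae P, (Y x w <= (x w + C)%:E)%E.
Hypothesis myopic_le : forall x z, L0 G x -> L0vec G z ->
  \forall w \ae P, (myopic v u x z w <= (x w + K)%:E)%E.
Local Notation obj := (objective v u Y).

(* The maximizer minimizes E[1 - contract (obj x z)], where [contract] is a bounded
   strictly increasing transform of [-oo, +oo]; Fatou's lemma gives existence, and
   pasting with a competitor shows that the minimizer dominates it a.s. *)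
Lemma objective_max x : L0 G x ->
  exists2 z, L0vec G z & forall z', L0vec G z' ->
    \forall w \ae P, (obj x z' w <= obj x z w)%E.
Proof.
move=> Lx; pose psi z w : \bar R := (1 - contract (obj x z w))%:E.
have GM : G `<=` measurable by exact: subset_trans HM.
have mobj z : L0vec G z -> sub_measurable G (obj x z).
  by move=> Lz; exact: (objective_low hv hu hY Lx Lz).1.
have mc z : L0vec G z -> measurable_fun setT (@contract R \o obj x z).
  by move=> Lz; apply: measurable_contract; exact: (sub_measurableW sG GM (mobj z Lz)).
have mpsi z : L0vec G z -> measurable_fun setT (psi z).
  by move=> Lz; apply/measurable_EFinP; apply: measurable_funB => //; exact: mc.
have psi0 z w : (0 <= psi z w)%E.
  rewrite lee_fin subr_ge0.
  by have := contract_le1 (obj x z w); rewrite ler_norml => /andP[].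
have psi2 z w : (psi z w <= 2%:E)%E.
  rewrite lee_fin; have := contract_le1 (obj x z w).
  by rewrite ler_norml => /andP[]; lra.
pose J z := (\int[P]_w psi z w)%E.
have J0 z : (0 <= J z)%E by apply: integral_ge0 => w _.
have Jfin z : L0vec G z -> J z \is a fin_num.
  move=> Lz; rewrite ge0_fin_numE//; apply: (@le_lt_trans _ _ (\int[P]_w (cst 2%:E w))%E).
    by apply: ge0_le_integral => //; exact: mpsi.
  by rewrite integral_cst//= probability_setT mule1 ltry.
pose A := J @` L0vec G.
have L00 : L0vec G (cst 0 : Omega -> 'rV[R]_d) by exact: L0vec0.
have Afin : ereal_inf A \is a fin_num.
  rewrite ge0_fin_numE; last by apply: le_ereal_inf_tmp => _ [z _ <-].
  apply: (@le_lt_trans _ _ (J (cst 0))); first by apply: ereal_inf_lbound; exists (cst 0).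
  by rewrite -ge0_fin_numE//; exact: Jfin.
have near k : exists z, L0vec G z /\ (J z < ereal_inf A + k.+1%:R^-1%:E)%E.
  have k0 : 0 < k.+1%:R^-1 :> R by rewrite invr_gt0.
  by have [_ [z Lz <-] ?] := lb_ereal_inf_adherent k0 Afin; exists z.
have /choice[z_ z_P] := near.
have Lz_ k : L0vec G (z_ k) by exact: (z_P k).1.
have cx : cvg_as P (fun=> x) x by apply: aeW => w; exact: cvg_cst.
(* The candidate: with constant wealth x, its objective dominates the limsup along the minimizing
   sequence of J. *)
have [z Lz usc] := objective_limsup_attained sG sH GH HM hv hu hY Yle myopic_le
  (fun=> Lx) Lx cx Lz_.
have Jz_ : (limn_einf (J \o z_) <= ereal_inf A)%E.
  apply: le_trans (limn_einf_sup _) _; apply: le_of_sub_inv => n.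
  rewrite leeBlDr//; apply/limn_esup_leP => c lc; exists n => // k /= nk.
  apply: le_trans (ltW (z_P k).2) _; apply: le_trans (ltW lc).
  by apply: leeD => //; rewrite lee_fin lef_pV2 ?posrE// ler_nat ltnS.
have Jz : (J z <= ereal_inf A)%E.
  (* Through the decreasing transform, [usc] says that psi at z is at most the liminf of psi along
     the sequence; Fatou's lemma then bounds J z by the liminf of J. *)
  have le := fatou P measurableT (fun k => mpsi _ (Lz_ k)) (fun k w _ => psi0 (z_ k) w).
  apply: le_trans Jz_; apply: le_trans le.
  apply: ae_ge0_le_integral => //.
  - exact: mpsi.
  - by move=> w _; rewrite limn_einf_lim; apply: lime_ge; [exact: is_cvg_einfs|
      apply: nearW => n; apply: le_ereal_inf_tmp => _ [k _ <-]].
  - by apply: measurableT_comp => //; apply: measurable_fun_limn_esup => k;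
      apply: measurableT_comp => //; exact: mpsi.
  - by apply: filterS usc => w usc _; exact: contract_limn_esup.
exists z => // z' Lz'.
pose E := [set w | (obj x z w < obj x z' w)%E].
have GE : G E.
  by apply: (sub_measurable_pred sG); apply: measurable_fun_lte; exact: mobj.
have GEC : G (~` E) by apply/(sub_sigmaP sG)/measurableC/(sub_sigmaP sG).
(* Using the competitor exactly where it does better yields the pointwise maximum of the two
   objectives. *)
pose y w := if w \in E then z' w else z w.
have Ly : L0vec G y by exact: L0vec_paste.
pose m w := maxe (obj x z' w) (obj x z w).
have ym : \forall w \ae P, obj x y w = m w.
  have yz' w : E w -> y w = z' w by move=> Ew; rewrite /y mem_set.
  have yz w : (~` E) w -> y w = z w by move=> Ew; rewrite /y memNset.
  have := objective_local sG sH GH hv hu hY GE Lx Lx Ly Lz' (fun _ _ => erefl) yz'.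
  have := objective_local sG sH GH hv hu hY GEC Lx Lx Ly Lz (fun _ _ => erefl) yz.
  apply: filterS2 => w e1 e2; have [Ew|nEw] := pselect (E w).
    by rewrite e2//; apply/esym/max_idPl; exact: ltW.
  by rewrite e1//; apply/esym/max_idPr; rewrite leNgt; exact/negP.
have mm : measurable_fun setT m.
  apply: measurable_maxe; first exact: (sub_measurableW sG GM (mobj _ Lz')).
  exact: (sub_measurableW sG GM (mobj _ Lz)).
have mcm := measurable_contract mm.
pose h w := (contract (m w) - contract (obj x z w))%:E.
have h0 w : (0 <= h w)%E by rewrite lee_fin subr_ge0 le_contract le_max lexx orbT.
have mh : measurable_fun setT h.
  by apply/measurable_EFinP; apply: measurable_funB => //; exact: mc.
have psim0 w : (0 <= (1 - contract (m w))%:E)%E.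
  by rewrite lee_fin subr_ge0; have := contract_le1 (m w); rewrite ler_norml => /andP[].
have mpsim : measurable_fun setT (fun w => (1 - contract (m w))%:E).
  by apply/measurable_EFinP; exact: measurable_funB.
have JyE : J y = (\int[P]_w (1 - contract (m w))%:E)%E.
  apply: ge0_ae_eq_integral => //; first exact: mpsi.
  by apply: filterS ym => w + _; rewrite /psi => ->.
have JzE : (J z = J y + \int[P]_w h w)%E.
  rewrite JyE -ge0_integralD//; apply: eq_integral => w _.
  by rewrite /psi /h -EFinD; congr EFin; lra.
(* J z is minimal and the finite J y cancels. Hence h >= 0 vanishes a.s., and injectivity of
   [contract] turns this into equality of the maximum with the objective at z. *)
have inth : (\int[P]_w h w <= 0)%E.
  have Jzy : (J z <= J y)%E by apply: le_trans Jz _; apply: ereal_inf_lbound; exists y.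
  by move: Jzy; rewrite JzE -{2}(adde0 (J y)) leeD2lE//; exact: Jfin.
have /ae_eq_integral_abs : (\int[P]_w `|h w| = 0)%E.
  have -> : (fun w => `|h w|)%E = h by apply/funext => w; rewrite gee0_abs.
  by apply/eqP; rewrite eq_le inth/=; apply: integral_ge0 => w _; exact: h0.
case/(_ measurableT mh) => N [mN PN NE]; exists N; split=> // w /= nle; apply: NE => /= hw.
apply: nle; have := hw I; rewrite /h => -[] /eqP; rewrite subr_eq0 => /eqP/contract_inj <-.
by rewrite le_max lexx.
Qed.

End maximum.

(** * Regularity of the maximized objective *)

Section maximum_admissible.
Context {R : realType} {dO : measure_display} {Omega : measurableType dO}.
Variables (P : probability Omega R) (d : nat) (G H : set (set Omega)).
Hypotheses (sG : sigma_algebra setT G) (sH : sigma_algebra setT H).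
Hypotheses (GH : G `<=` H) (HM : H `<=` measurable).
Variables (v : (Omega -> R) -> (Omega -> 'rV[R]_d) -> Omega -> R)
  (u : (Omega -> R) -> (Omega -> \bar R) -> (Omega -> 'rV[R]_d) -> Omega -> \bar R).
Hypotheses (hv : wealth_map P G H v) (hu : utility_map P G H u).
Variable Y : (Omega -> R) -> Omega -> \bar R.
Hypothesis hY : admissible P H Y.
Variables C K : R.
Hypothesis Yle : forall x, L0 H x -> \forall w \ae P, (Y x w <= (x w + C)%:E)%E.
Hypothesis myopic_le : forall x z, L0 G x -> L0vec G z ->
  \forall w \ae P, (myopic v u x z w <= (x w + K)%:E)%E.
Local Notation obj := (objective v u Y).

(** Domination of each competitor separately, each with its own null set; [esssup_max] converts this
    into attainment of the essential supremum. *)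
Definition maximizer x z := [/\ L0vec G z &
  forall z', L0vec G z' -> \forall w \ae P, (obj x z' w <= obj x z w)%E].

(** [Y'] stands for y_t, known here only through its measurability and the attained maximum
    [Y'max]. *)
Variable Y' : (Omega -> R) -> Omega -> \bar R.
Hypothesis mY' : forall x, L0 G x -> sub_measurable G (Y' x).
Hypothesis Y'max : forall x, L0 G x -> exists2 z, maximizer x z &
  \forall w \ae P, Y' x w = obj x z w.

Lemma maximum_le x : L0 G x -> \forall w \ae P, (Y' x w <= (x w + (K + C))%:E)%E.
Proof.
move=> Lx; have [z [Lz _]] := Y'max Lx.
by have := objective_le hv hu hY Yle myopic_le Lx Lz; apply: filterS2 => w + ->.
Qed.

Lemma maximum_admissible : admissible P G Y'.
Proof.
split.
- move=> x Lx; split; first exact: mY'.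
  by apply: filterS (maximum_le Lx) => w /le_lt_trans; apply; rewrite ltry.
- move=> A x_ /random_index_cpartition[theta mtheta AE] Lx_; rewrite !AE.
  pose xt (w : Omega) := x_ (theta w) w.
  have Lxt : L0 G xt by exact: L0_reindex.
  have /choice[z_ z_P] : forall k, exists z, maximizer (x_ k) z /\
      \forall w \ae P, Y' (x_ k) w = obj (x_ k) z w.
    by move=> k; have [z zm zE] := Y'max (Lx_ k); exists z.
  have Lz_ k : L0vec G (z_ k) by have [[]] := z_P k.
  have /ae_foralln z_E : forall k, \forall w \ae P, Y' (x_ k) w = obj (x_ k) (z_ k) w.
    by move=> k; have [] := z_P k.
  have [z [Lz zmax] zE] := Y'max Lxt.
  (* The pasted blockwise maximizers compete at the concatenated wealth; conversely, the maximizer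
     found there competes in every block. *)
  have ge1 := zmax _ (L0vec_reindex sG mtheta Lz_).
  have e1 := objective_reindex sG sH GH hv hu hY mtheta Lx_ Lz_.
  have e2 := objective_reindex sG sH GH hv hu hY mtheta Lx_ (fun=> Lz).
  have /ae_foralln le1 : forall k, \forall w \ae P, (obj (x_ k) z w <= obj (x_ k) (z_ k) w)%E.
    by move=> k; have [[_ mx] _] := z_P k; exact: mx.
  apply/ae_eq_setTP.
  have ge : \forall w \ae P, (Y' (x_ (theta w)) w <= Y' xt w)%E.
    near=> w; rewrite (near z_E w)// (near zE w)//.
    by rewrite -[leLHS](near e1 w)//; exact: (near ge1 w).
  have le : \forall w \ae P, (Y' xt w <= Y' (x_ (theta w)) w)%E.
    near=> w; rewrite (near z_E w)// (near zE w)//.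
    by rewrite [leLHS](near e2 w)//; exact: (near le1 w).
  by move: ge le; apply: filterS2 => w ge le; apply/eqP; rewrite eq_le le ge.
- move=> x x' Lx Lx' xx'; have [z [Lz _] zE] := Y'max Lx.
  have [z' [Lz' zmax'] zE'] := Y'max Lx'.
  have le1 := objective_le_fst hv hu hY Lx Lx' Lz xx'; have le2 := zmax' _ Lz.
  near=> w; rewrite (near zE w)// (near zE' w)//.
  by apply: le_trans (near le1 w _) (near le2 w _).
- move=> x_ x Lx_ Lx xx.
  have /choice[z_ z_P] : forall k, exists z, maximizer (x_ k) z /\
      \forall w \ae P, Y' (x_ k) w = obj (x_ k) z w.
    by move=> k; have [z zm zE] := Y'max (Lx_ k); exists z.
  have Lz_ k : L0vec G (z_ k) by have [[]] := z_P k.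
  have /ae_foralln z_E : forall k, \forall w \ae P, Y' (x_ k) w = obj (x_ k) (z_ k) w.
    by move=> k; have [] := z_P k.
  (* The vectors are maximizers for the x_k, so the limsup of the maxima is bounded by the objective
     at one vector for x, hence by the maximum at x. *)
  have [z Lz usc] := objective_limsup_attained sG sH GH HM hv hu hY Yle myopic_le
    Lx_ Lx xx Lz_.
  have [zx [Lzx zmax] zE] := Y'max Lx.
  have le1 := zmax _ Lz.
  near=> w; rewrite (near zE w)//.
  rewrite (_ : (fun k => Y' (x_ k) w) = fun k => obj (x_ k) (z_ k) w).
    by apply: le_trans (near usc w _) (near le1 w _).
  by apply/funext => k; exact: (near z_E w).
Unshelve. all: by end_near.
Qed.

End maximum_admissible.

(** * Backward recursion and optimal processes *)

Section recursion.
Context {R : realType} {dO : measure_display} {Omega : measurableType dO}.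
Variables (P : probability Omega R) (T d : nat) (F : nat -> set (set Omega)).
Hypothesis hF : filtration T F.
Variable v : nat -> (Omega -> R) -> (Omega -> 'rV[R]_d) -> Omega -> R.
Hypothesis hv : forall t, (t < T)%N -> wealth_map P (F t) (F t.+1) (v t).
Variable u : nat -> (Omega -> R) -> (Omega -> \bar R) -> (Omega -> 'rV[R]_d) ->
  Omega -> \bar R.
Hypothesis hu : forall t, (t < T)%N -> utility_map P (F t) (F t.+1) (u t).
Variable K : R.
Hypothesis hK : forall t x, (t < T)%N -> L0 (F t) x ->
  \forall w \ae P,
    (esssup P (F t)
       [set u t x (EFin \o v t x z) z | z in @L0vec R dO Omega d (F t)] w
     - (x w)%:E <= K%:E)%E.
Local Notation y := (value P T F v u).
Local Notation obj t := (objective (v t) (u t) (y t.+1)).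

Lemma filtration_sigma_algebra t : (t <= T)%N -> sigma_algebra setT (F t).
Proof. by have [] := hF => h _ _; exact: h. Qed.

Lemma filtration_measurable t : (t <= T)%N -> F t `<=` measurable.
Proof.
have [_ Fle FT] := hF; move=> /subnKC; move: (T - t)%N => n.
elim: n t => [|n IH] t; first by rewrite addn0 => ->; rewrite FT.
move=> tn; apply: subset_trans (IH t.+1 _); last by rewrite addSnnS.
by apply: Fle; rewrite -tn -addSnnS leq_addr.
Qed.

Lemma valueT x : y T x = EFin \o x.
Proof. by rewrite /value ltnn. Qed.

Lemma compose_low n s (x : nat -> Omega -> R) (z : nat -> Omega -> 'rV[R]_d) :
  (s + n)%N = T -> (forall r, (s <= r <= T)%N -> L0 (F r) (x r)) ->
  (forall r, (s <= r < T)%N -> L0vec (F r) (z r)) ->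
  L0low P (F s) (compose u x z s n).
Proof.
elim: n s => [|n IH] s sT Lx Lz /=.
  by apply: L0low_EFin; apply: Lx; rewrite leqnn -sT leq_addr.
have sltT : (s < T)%N by rewrite -sT -addSnnS leq_addr.
apply: (utility_L0 (hu sltT)).
- by apply: Lx; rewrite leqnn ltnW.
- apply: IH; first by rewrite addSnnS.
    by move=> r /andP[sr rT]; apply: Lx; rewrite rT ltnW.
  by move=> r /andP[sr rT]; apply: Lz; rewrite rT ltnW.
- by apply: Lz; rewrite leqnn.
Qed.

Lemma attainable_low t x p : (t <= T)%N -> attainable P T F v t x p ->
  L0low P (F t) (compose u p.1 p.2 t (T - t)).
Proof.
move=> tT [_ Lx Lz]; apply: compose_low => //; first by rewrite subnKC.
by move=> r /Lz[].
Qed.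

Lemma value_is_esssup t x : (t < T)%N ->
  is_esssup P (F t) [set compose u p.1 p.2 t (T - t) | p in attainable P T F v t x] (y t x).
Proof.
move=> tT; rewrite /value tT; apply: is_esssup_esssup.
- exact/filtration_sigma_algebra/ltnW.
- exact/filtration_measurable/ltnW.
- by move=> _ [p pA <-]; exact: (attainable_low (ltnW tT) pA).1.
Qed.

Lemma compose_le_value t x p : (t <= T)%N -> attainable P T F v t x p ->
  \forall w \ae P, (compose u p.1 p.2 t (T - t) w <= y t x w)%E.
Proof.
rewrite leq_eqVlt => /predU1P[->|tT] pA; last first.
  by have [_ ub _] := value_is_esssup x tT; apply: ub; exists p.
rewrite subnn valueT /=; have [/ae_eq_setTP px _ _] := pA.
by apply: filterS px => w /= ->.
Qed.

Lemma myopic_le_bound t x z : (t < T)%N -> L0 (F t) x -> L0vec (F t) z ->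
  \forall w \ae P, (myopic (v t) (u t) x z w <= (x w + K)%:E)%E.
Proof.
move=> tT Lx Lz; have := hK tT Lx.
have [_ ub _] : is_esssup P (F t)
    [set u t x (EFin \o v t x z) z | z in @L0vec R dO Omega d (F t)]
    (esssup P (F t) [set u t x (EFin \o v t x z) z | z in @L0vec R dO Omega d (F t)]).
  apply: is_esssup_esssup.
  - exact/filtration_sigma_algebra/ltnW.
  - exact/filtration_measurable/ltnW.
  - move=> _ [z' Lz' <-]; apply: (utility_L0 (hu tT) Lx _ Lz').1.
    by apply: L0low_EFin; exact: (wealth_L0 (hv tT)).
have : \forall w \ae P, (myopic (v t) (u t) x z w <= esssup P (F t)
    [set u t x (EFin \o v t x z) z | z in @L0vec R dO Omega d (F t)] w)%E.
  by apply: ub; exists z.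
apply: filterS2 => w le1 le2; apply: (le_trans le1).
by rewrite EFinD addeC -leeBlDr.
Qed.

(** Carried through the induction: an optimal process from time t+1, extended by one step, shows
    that y_t is at least the maximized objective. *)
Definition attained t := forall x, L0 (F t) x -> exists2 p,
  attainable P T F v t x p & \forall w \ae P, y t x w = compose u p.1 p.2 t (T - t) w.

(** The constant may depend on t: each backward step adds K to it. *)
Definition affinely_bounded t := exists C, forall x, L0 (F t) x ->
  \forall w \ae P, (y t x w <= (x w + C)%:E)%E.

Section step.
Variable t : nat.
Hypothesis tT : (t < T)%N.
Hypotheses (yadm : admissible P (F t.+1) (y t.+1)) (ybnd : affinely_bounded t.+1)
  (yatt : attained t.+1).

Let sG : sigma_algebra setT (F t) := filtration_sigma_algebra (ltnW tT).
Let sH : sigma_algebra setT (F t.+1) := filtration_sigma_algebra tT.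
Let GM : F t `<=` measurable := @filtration_measurable _ (ltnW tT).
Let HM : F t.+1 `<=` measurable := @filtration_measurable _ tT.
Let GH : F t `<=` F t.+1. Proof. by have [_ + _] := hF; exact. Qed.
Let yincr : increasing1 P (F t.+1) (y t.+1). Proof. by have [] := yadm. Qed.
Let ylow x : L0 (F t.+1) x -> L0low P (F t.+1) (y t.+1 x).
Proof. by have [h _ _ _] := yadm; exact: h. Qed.

(** Upper bound: the tail of any process from x is worth at most y_(t+1), so the process is worth at
    most the objective at its first vector, hence at the maximizer z. Lower bound: z followed by an
    optimal process from v_t(x, z) attains that objective. *)
Lemma value_step x : L0 (F t) x ->
  exists2 z, maximizer P (F t) (v t) (u t) (y t.+1) x z &
    (\forall w \ae P, y t x w = obj t x z w) /\
    exists2 p, attainable P T F v t x p &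
      \forall w \ae P, y t x w = compose u p.1 p.2 t (T - t) w.
Proof.
move=> Lx; have [C yC] := ybnd.
have [z Lz zmax] := objective_max sG sH GH HM (hv tT) (hu tT) yadm yC
  (fun x z => @myopic_le_bound t x z tT) Lx.
exists z; first by split.
have [mY ub least] := value_is_esssup x tT.
have le : \forall w \ae P, (y t x w <= obj t x z w)%E.
  apply: least.
    exact: (sub_measurableW sG GM (objective_low (hv tT) (hu tT) yadm Lx Lz).1).
  move=> _ [p [px Lp pv] <-].
  have Lx' : L0 (F t) (p.1 t) by apply: Lp; rewrite leqnn ltnW.
  have [Lz' pv'] : L0vec (F t) (p.2 t) /\ p.1 t.+1 = v t (p.1 t) (p.2 t) %[ae P].
    by apply: pv; rewrite leqnn.
  have Lx'' : L0 (F t.+1) (p.1 t.+1) by apply: Lp; rewrite leqnSn.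
  have Lv : L0 (F t.+1) (v t (p.1 t) (p.2 t)) by exact: (wealth_L0 (hv tT)).
  (* The tail starts at its own x_(t+1), which equals v_t(x_t, z_t) only a.s.; [e1] moves the value
     function across this equality. *)
  have pA : attainable P T F v t.+1 (p.1 t.+1) p.
    split; first exact: aeW.
      by move=> s /andP[ts sT]; apply: Lp; rewrite sT ltnW.
    by move=> s /andP[ts sT]; apply: pv; rewrite sT ltnW.
  rewrite -subnSK//=.
  have le1 := compose_le_value tT pA.
  have e1 := increasing1_congr yincr Lx'' Lv ((ae_eq_setTP _ _ _).1 pv').
  have {le1 e1}le1 : \forall w \ae P,
      (compose u p.1 p.2 t.+1 (T - t.+1) w <= y t.+1 (v t (p.1 t) (p.2 t)) w)%E.
    by move: le1 e1; apply: filterS2 => w + <-.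
  have {}le1 := utility_incr_snd (hu tT) Lx' (attainable_low tT pA) (ylow Lv) Lz' le1.
  have e2 := objective_congr (hv tT) (hu tT) yadm Lx' Lx Lz' Lz'
    ((ae_eq_setTP _ _ _).1 px) (aeW _ (fun=> erefl)).
  have le2 := zmax _ Lz'.
  by move: le1 e2 le2; apply: filterS3 => w le1 e2; apply: le_trans; rewrite -e2.
have Lv : L0 (F t.+1) (v t x z) by exact: (wealth_L0 (hv tT)).
have [p [/ae_eq_setTP px Lp pv] pE] := yatt Lv.
(* The optimal process from v_t(x, z), with x and z put in at time t. Its entries before t do not
   enter [attainable] or [compose] from t on. *)
pose q := ((fun s => if s == t then x else p.1 s),
           (fun s => if s == t then z else p.2 s)).
have qp1 s : (t < s)%N -> q.1 s = p.1 s by move=> ts; rewrite /q/= gtn_eqF.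
have qp2 s : (t < s)%N -> q.2 s = p.2 s by move=> ts; rewrite /q/= gtn_eqF.
have qt1 : q.1 t = x by rewrite /q/= eqxx.
have qt2 : q.2 t = z by rewrite /q/= eqxx.
clearbody q.
have qA : attainable P T F v t x q.
  split.
  - by apply: aeW => w _; rewrite qt1.
  - move=> s /andP[]; rewrite leq_eqVlt => /predU1P[<-|ts] sT; first by rewrite qt1.
    by rewrite qp1//; apply: Lp; rewrite ts.
  - move=> s /andP[]; rewrite leq_eqVlt => /predU1P[<-|ts] sT.
      by rewrite qt1 qt2 qp1//; split=> //; exact/ae_eq_setTP.
    rewrite (qp1 s)// (qp1 s.+1) 1?ltnW// (qp2 s)//.
    by apply: pv; rewrite ts.
have composeE n s : (t < s)%N -> compose u q.1 q.2 s n = compose u p.1 p.2 s n.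
  elim: n s => [|n IH] s ts /=; first by rewrite qp1.
  by rewrite qp1// qp2// IH// ltnW.
have qE : compose u q.1 q.2 t (T - t) = u t x (compose u p.1 p.2 t.+1 (T - t.+1)) z.
  by rewrite -subnSK//= qt1 qt2 composeE.
have pA : attainable P T F v t.+1 (v t x z) p by split=> //; exact/ae_eq_setTP.
have e := utility_congr_snd (hu tT) Lx (ylow Lv) (attainable_low tT pA) Lz pE.
have ge : \forall w \ae P, (compose u q.1 q.2 t (T - t) w <= y t x w)%E.
  by apply: ub; exists q.
have qobj : \forall w \ae P, obj t x z w = compose u q.1 q.2 t (T - t) w.
  by rewrite qE.
have yE : \forall w \ae P, y t x w = obj t x z w.
  by move: le ge qobj; apply: filterS3 => w le ge qo; apply/eqP; rewrite eq_le le qo.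
split=> //; exists q => //.
by move: yE qobj; apply: filterS2 => w ->.
Qed.

End step.

(** Induction on T - t; all three properties at t+1 enter [value_step], which in turn yields them at
    t. *)
Lemma value_admissible t : (t <= T)%N ->
  [/\ admissible P (F t) (y t), affinely_bounded t & attained t].
Proof.
move=> /subnKC; move: (T - t)%N => n; elim: n t => [|n IH] t.
  rewrite addn0 => ->; split.
  - have := admissible_EFin P (F T); congr (admissible _ _ _).
    by apply/funext => x; rewrite valueT.
  - by exists 0 => x _; apply: aeW => w; rewrite valueT addr0.
  - move=> x Lx; exists (fun=> x, fun=> cst 0).
      split; first exact: aeW.
        by move=> s /andP[Ts sT]; rewrite (_ : s = T)//; apply/eqP; rewrite eqn_leq sT.
      by move=> s /andP[Ts sT]; move: (leq_ltn_trans Ts sT); rewrite ltnn.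
    by apply: aeW => w; rewrite valueT subnn.
rewrite -addSnnS => tn; have [yadm [C yC] yatt] := IH _ tn.
have tT : (t < T)%N by rewrite -tn leq_addr.
have sG := filtration_sigma_algebra (ltnW tT); have sH := filtration_sigma_algebra tT.
have HM := filtration_measurable tT.
have GH : F t `<=` F t.+1 by have [_ + _] := hF; exact.
have step := value_step tT yadm (ex_intro _ C yC) yatt.
have mY x : L0 (F t) x -> sub_measurable (F t) (y t x).
  by move=> Lx; have [] := value_is_esssup x tT.
have stepmax x : L0 (F t) x -> exists2 z, maximizer P (F t) (v t) (u t) (y t.+1) x z &
    \forall w \ae P, y t x w = obj t x z w.
  by move=> /step[z zm [zE _]]; exists z.
have myo x z := @myopic_le_bound t x z tT.
split.
- exact: (maximum_admissible sG sH GH HM (hv tT) (hu tT) yadm yC myo mY stepmax).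
- exists (K + C) => x Lx.
  exact: (maximum_le (hv tT) (hu tT) yadm yC myo stepmax Lx).
- by move=> x /step[z zm [_ att]].
Qed.

Lemma value_attained_max t x : (t < T)%N -> L0 (F t) x ->
  is_max P (F t) (@L0vec R dO Omega d (F t)) (one_step P T F v u t x) (y t x).
Proof.
move=> tT Lx; have [yadm ybnd yatt] := value_admissible tT.
have sG := filtration_sigma_algebra (ltnW tT).
have GM := filtration_measurable (ltnW tT).
have [z [Lz zmax] [zE _]] := value_step tT yadm ybnd yatt Lx.
have mobj z' : L0vec (F t) z' -> sub_measurable (F t) (obj t x z').
  by move=> Lz'; exact: (objective_low (hv tT) (hu tT) yadm Lx Lz').1.
have supE := esssup_max sG GM Lz mobj zmax.
split; first by apply/ae_eq_setTP; move: zE supE; apply: filterS2 => w -> ->.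
by exists z; split => //; apply/ae_eq_setTP; apply: filterS supE => w ->.
Qed.

(** Induction on T - t: by the recursion and the argmax condition y_t is the objective at z_t, and
    the continuation value inside it is the composition from t+1 on. Starting at [xs t] itself lets
    the induction hypothesis apply to the tail. *)
Lemma value_argmax_process t (xs : nat -> Omega -> R) (zs : nat -> Omega -> 'rV[R]_d) :
  (t <= T)%N ->
  (forall s, (t <= s <= T)%N -> L0 (F s) (xs s)) ->
  (forall s, (t <= s < T)%N ->
     argmax P (F s) (@L0vec R dO Omega d (F s)) (one_step P T F v u s (xs s)) (zs s) /\
     xs s.+1 = v s (xs s) (zs s) %[ae P]) ->
  \forall w \ae P, y t (xs t) w = compose u xs zs t (T - t) w.
Proof.
move=> tT; move/subnKC : (tT); move: (T - t)%N => n; elim: n t {tT} => [|n IH] t.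
  by rewrite addn0 => -> Lx _; apply: aeW => w; rewrite valueT.
move=> tn Lx hs; have tT : (t < T)%N by rewrite -tn -addSnnS leq_addr.
have Lxt : L0 (F t) (xs t) by apply: Lx; rewrite leqnn ltnW.
have Lxt1 : L0 (F t.+1) (xs t.+1) by apply: Lx; rewrite leqnSn.
have [[Lz /ae_eq_setTP zE] /ae_eq_setTP vE] := hs t (introT andP (conj (leqnn t) tT)).
have Lv : L0 (F t.+1) (v t (xs t) (zs t)) by exact: (wealth_L0 (hv tT)).
have [[ylow _ yincr _] _ _] := value_admissible tT.
have e1 := increasing1_congr yincr Lxt1 Lv vE.
have Lx' s : (t < s <= T)%N -> L0 (F s) (xs s).
  by move=> /andP[ts sT]; apply: Lx; rewrite sT ltnW.
have e2 : \forall w \ae P, y t.+1 (xs t.+1) w = compose u xs zs t.+1 n w.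
  apply: IH => //; first by rewrite addSnnS.
  by move=> s /andP[ts sT]; apply: hs; rewrite sT ltnW.
have e3 : \forall w \ae P, y t.+1 (v t (xs t) (zs t)) w = compose u xs zs t.+1 n w.
  by move: e1 e2; apply: filterS2 => w -> .
have Lc : L0low P (F t.+1) (compose u xs zs t.+1 n).
  apply: compose_low => //; first by rewrite addSnnS.
  by move=> s /andP[ts sT]; have [[]] := hs s (introT andP (conj (ltnW ts) sT)).
have e4 := utility_congr_snd (hu tT) Lxt (ylow _ Lv) Lc Lz e3.
have [/ae_eq_setTP yE _] := value_attained_max tT Lxt.
by move: yE zE e4; apply: filterS3 => w -> <- /=.
Qed.

End recursion.

(** * The dynamic programming principle *)

Theorem proposition4p1 (R : realType) (dO : measure_display)
  (Omega : measurableType dO) (P : probability Omega R)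
  (T d : nat) (F : nat -> set (set Omega)) (hF : filtration T F)
  (v : nat -> (Omega -> R) -> (Omega -> 'rV[R]_d) -> Omega -> R)
  (hv : forall t, (t < T)%N -> wealth_map P (F t) (F t.+1) (v t))
  (u : nat -> (Omega -> R) -> (Omega -> \bar R) -> (Omega -> 'rV[R]_d) ->
       Omega -> \bar R)
  (hu : forall t, (t < T)%N -> utility_map P (F t) (F t.+1) (u t))
  (K : R) (K_gt0 : 0 < K)
  (hK : forall t x, (t < T)%N -> L0 (F t) x ->
     \forall w \ae P,
       (esssup P (F t)
          [set u t x (EFin \o v t x z) z | z in @L0vec R dO Omega d (F t)] w
        - (x w)%:E <= K%:E)%E) :
  let y := value P T F v u in
  let obj := one_step P T F v u in
  [/\ forall t, (t <= T)%N ->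
        [/\ forall x, L0 (F t) x -> L0low P (F t) (y t x),
            stable1 P (F t) (y t),
            increasing1 P (F t) (y t) &
            seq_usc1 P (F t) (y t)],
      forall x, L0 (F T) x -> y T x = EFin \o x %[ae P],
      forall t x, (t < T)%N -> L0 (F t) x ->
        is_max P (F t) (L0vec (F t)) (obj t x) (y t x) &
      forall t x, (t < T)%N -> L0 (F t) x ->
      forall (xs : nat -> Omega -> R) (zs : nat -> Omega -> 'rV[R]_d),
        xs t = x %[ae P] ->
        (forall s, (t <= s <= T)%N -> L0 (F s) (xs s)) ->
        (forall s, (t <= s < T)%N ->
           argmax P (F s) (L0vec (F s)) (obj s (xs s)) (zs s) /\
           xs s.+1 = v s (xs s) (zs s) %[ae P]) ->
        attainable P T F v t x (xs, zs) /\
        y t x = compose u xs zs t (T - t) %[ae P]].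
Proof.
move=> y obj; split.
- by move=> t tT; have [] := value_admissible hF hv hu hK tT.
- by move=> x _; apply: aeW => w _; rewrite /y valueT.
- by move=> t x tT Lx; exact: (value_attained_max hF hv hu hK tT Lx).
- move=> t x tT Lx xs zs xsx Lxs hs; split.
    by split => // s ts; have [[Lz _] e] := hs s ts; split.
  have [[_ _ yincr _] _ _] := value_admissible hF hv hu hK (ltnW tT).
  have Lxt : L0 (F t) (xs t) by apply: Lxs; rewrite leqnn ltnW.
  (* The process starts at x only a.s., so y_t is moved from [xs t] to x by its independence of
     representatives. *)
  have e1 := increasing1_congr yincr Lxt Lx ((ae_eq_setTP _ _ _).1 xsx).
  have e2 := value_argmax_process hF hv hu hK (ltnW tT) Lxs hs.
  by apply/ae_eq_setTP; move: e1 e2; apply: filterS2 => w ->.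
Qed.
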